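(* Let $X$ be a systolic-by-function length complex. Then $X$ is large.
   Context: A length function for a simplicial complex $X$ is a function $l:\text{edges}(X)\to[0,\frac12]$ such that, for the three edges $e_0,e_1,e_2$ of any triangle (2-simplex) of $X$: (i) $l(e_0)+l(e_1)+l(e_2)\leq 1$; (ii) $l(e_i)\leq l(e_{i+1})+l(e_{i+2})$ (indices modulo 3). A simplicial complex together with a length function is called a length complex. A cycle in $X$ is a subcomplex $\sigma$ homeomorphic to $S^1$; its length $l(\sigma)$ is the sum of the lengths of its edges. A subcomplex $Y$ of $X$ is full if any simplex of $X$ spanned by a set of vertices of $Y$ is a simplex of $Y$. $X$ is flag if every finite set of vertices pairwise connected by edges spans a simplex of $X$. The link $Lk_X(v)$ of a vertex $v$ is the subcomplex of simplices of $X$ that are disjoint from $v$ and together with $v$ span a simplex of $X$; links in a length complex carry the restricted length function. A length complex is large if it is flag and every full cycle has length greater than or equal to $2$. It is locally large if the link of every vertex is large. It is systolic-by-function if it is connected, simply connected and locally large. *)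

(* Defs.v *)
From HB Require Import structures.
From mathcomp Require Import all_boot all_order all_algebra finmap.
From mathcomp Require Import all_classical all_reals all_analysis.
Import Order.TTheory GRing.Theory Num.Theory.
Import numFieldNormedType.Exports.

Set Implicit Arguments.
Unset Strict Implicit.
Unset Printing Implicit Defensive.

Local Open Scope classical_set_scope.
Local Open Scope ring_scope.

(* Not every element of V need be a vertex, so that subcomplexes and links of
   a complex on V are again complexes on V. *)
Record complex (V : choiceType) := Complex {
  simplex :> {fset V} -> Prop;
  simplex_neq0 : forall s, simplex s -> s != fset0;
  simplex_face : forall s t, simplex s -> t != fset0 -> (t `<=` s)%fset ->
    simplex t
}.

Definition vertex (V : choiceType) (X : complex V) (v : V) : Prop :=
  X [fset v]%fset.

Definition edge (V : choiceType) (X : complex V) : set {fset V} :=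
  [set e | X e /\ #|` e| = 2%N].

Definition subcomplex (V : choiceType) (Y X : complex V) : Prop :=
  forall s, Y s -> X s.

Definition full (V : choiceType) (Y X : complex V) : Prop :=
  forall s, X s -> (forall v, v \in s -> vertex Y v) -> Y s.

Definition flag (V : choiceType) (X : complex V) : Prop :=
  forall s : {fset V}, s != fset0 ->
    (forall v, v \in s -> vertex X v) ->
    (forall u v, u \in s -> v \in s -> u != v -> edge X [fset u; v]%fset) ->
    X s.

Section Link.
Variables (V : choiceType) (X : complex V) (v : V).

Definition link_simplex : set {fset V} :=
  [set s | [/\ X s, v \notin s & X (v |` s)%fset]].

Fact link_neq0 s : link_simplex s -> s != fset0.
Proof. by case=> /simplex_neq0. Qed.

Fact link_face s t :
  link_simplex s -> t != fset0 -> (t `<=` s)%fset -> link_simplex t.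
Proof.
move=> [Xs vs Xvs] t0 ts; split.
- exact: simplex_face Xs t0 ts.
- by apply: contra vs; apply: (fsubsetP ts).
- apply: simplex_face Xvs _ (fsetUS _ ts).
  by apply/fset0Pn; exists v; rewrite fset1U1.
Qed.

Definition link : complex V := Complex link_neq0 link_face.

End Link.

Section Realization.
Variables (R : realType) (V : choiceType) (X : complex V).

(* [supported s x]: x is a point of the closed geometric simplex on s. *)
Definition supported (s : {fset V}) (x : V -> R) : Prop :=
  forall v, v \notin s -> x v = 0.

Record realization := Realization {
  bary :> V -> R;
  bary_ge0 : forall v, 0 <= bary v;
  bary_supp : exists s, [/\ X s, supported s bary & \sum_(v <- s) bary v = 1]
}.

HB.instance Definition _ := gen_eqMixin realization.
HB.instance Definition _ := gen_choiceMixin realization.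

(* The weak topology: a set is open iff its trace on each closed simplex |s|
   is open for the Euclidean topology of |s|, here given by the sup metric on
   barycentric coordinates. *)
Definition weak_open : set_system realization :=
  [set U | forall s, X s -> forall x : realization, supported s x -> U x ->
    exists2 e : R, 0 < e & forall y : realization, supported s y ->
      (forall v, v \in s -> `|x v - y v| < e) -> U y].

Fact weak_openT : weak_open setT.
Proof. by move=> s _ x _ _; exists 1. Qed.

Fact weak_openI : setI_closed weak_open.
Proof.
move=> A B oA oB s Xs x sx [Ax Bx].
have [a a0 aA] := oA s Xs x sx Ax; have [b b0 bB] := oB s Xs x sx Bx.
exists (Num.min a b); first by rewrite lt_min a0.
move=> y sy xy; split.
- by apply: aA => // v /xy; rewrite lt_min => /andP[].
- by apply: bB => // v /xy; rewrite lt_min => /andP[].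
Qed.

Fact weak_open_bigU (I : Type) (f : I -> set realization) :
  (forall i, weak_open (f i)) -> weak_open (\bigcup_i f i).
Proof.
move=> of_ s Xs x sx [i _ fx]; have [e e0 ef] := of_ i s Xs x sx fx.
by exists e => // y sy xy; exists i => //; apply: ef.
Qed.

HB.instance Definition _ :=
  isOpenTopological.Build realization weak_openT weak_openI weak_open_bigU.

End Realization.
Arguments realization : clear implicits.

(* The fundamental group at every base point is trivial; connectedness is a
   separate hypothesis. *)
Definition simply_connected (R : realType) (T : topologicalType) : Prop :=
  forall f : R -> T, {within `[0, 1], continuous f} -> f 0 = f 1 ->
    exists H : R * R -> T,
      [/\ {within `[0, 1] `*` `[0, 1], continuous H},
          forall t : R, 0 <= t <= 1 -> H (t, 0) = f t,
          forall t : R, 0 <= t <= 1 -> H (t, 1) = f 0 &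
          forall u : R, 0 <= u <= 1 -> H (0, u) = f 0 /\ H (1, u) = f 0].

Definition circle (R : realType) : set (R * R) :=
  [set p | p.1 ^+ 2 + p.2 ^+ 2 = 1].
Arguments circle : clear implicits.

Definition homeomorphic_to_circle (R : realType) (T : topologicalType) : Prop :=
  exists (f : T -> R * R) (g : R * R -> T),
    [/\ continuous f, {within circle R, continuous g},
        forall x, circle R (f x), forall x, g (f x) = x &
        forall p, circle R p -> f (g p) = p].

Definition cycle (R : realType) (V : choiceType) (s X : complex V) : Prop :=
  subcomplex s X /\ homeomorphic_to_circle R (realization R V s).

(* A length function is total on finite sets, but only its values on the edges
   of X are constrained or used.  In the triangle inequality it is enough to
   single out one edge, as a, b, c range over all orderings. *)
Definition length_function (R : realType) (V : choiceType) (X : complex V)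
    (l : {fset V} -> R) : Prop :=
  (forall e, edge X e -> 0 <= l e <= 2^-1) /\
  (forall a b c : V, a != b -> b != c -> c != a -> X [fset a; b; c]%fset ->
     l [fset a; b]%fset + l [fset b; c]%fset + l [fset c; a]%fset <= 1 /\
     l [fset a; b]%fset <= l [fset b; c]%fset + l [fset c; a]%fset).

Record length_complex (R : realType) (V : choiceType) := LengthComplex {
  underlying :> complex V;
  len : {fset V} -> R;
  lenP : length_function underlying len
}.

Fact link_lenP (R : realType) (V : choiceType) (X : length_complex R V) (v : V) :
  length_function (link X v) (len X).
Proof.
have [l01 ltri] := lenP X; split.
- by move=> e [[Xe _ _] e2]; apply: l01.
- by move=> a b c ab bc ca [Xabc _ _]; apply: ltri.
Qed.

Definition length_link (R : realType) (V : choiceType)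
    (X : length_complex R V) (v : V) : length_complex R V :=
  LengthComplex (link_lenP X v).

(* The sum of nonnegative terms over the set of edges, in the extended reals;
   this set is finite when s is a cycle, its realization being compact. *)
Definition cycle_length (R : realType) (V : choiceType)
    (X : length_complex R V) (s : complex V) : \bar R :=
  (\esum_(e in edge s) (len X e)%:E)%E.

Definition large (R : realType) (V : choiceType) (X : length_complex R V) : Prop :=
  flag X /\
  forall s : complex V, cycle R s X -> full s X -> (2%:E <= cycle_length X s)%E.

Definition locally_large (R : realType) (V : choiceType)
    (X : length_complex R V) : Prop :=
  forall v, vertex X v -> large (length_link X v).

Definition systolic_by_function (R : realType) (V : choiceType)
    (X : length_complex R V) : Prop :=
  [/\ connected [set: realization R V X],
      simply_connected R (realization R V X) & locally_large X].

(* Main.v *)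
Require Import Defs.
From HB Require Import structures.
From mathcomp Require Import all_boot all_order all_algebra finmap.
From mathcomp Require Import all_classical all_reals all_analysis.
From mathcomp Require Import zify ring lra.

(** Read the length of an edge as an angle: a triangle abc has the angle l(bc)
at a, in units of pi.  Condition (i) says that the angles of a triangle add up
to at most pi, and largeness of the links says that the curvature at a vertex
is nonpositive.  The theorem is then an instance of Gauss-Bonnet: a closed edge
walk s bounding a disc of nonpositive curvature, in which no triangle contains
two successive edges of s, has length at least 2 (closed_walk_length).

Discs are not represented by planar maps.  A disc is a sweep: the walk s is
contracted to a point by pushing an edge ab across a triangle abx, which
replaces it by the path a, x, b, and by folding a spur c, b, c.  A vertex x
born in a push becomes interior when it is folded away.  The triangles at x
that the sweep has crossed form a path in the link of x, which is closed at
that moment.  If its length, the total angle at x, were less than 2, then the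
closed path could be filled inside the link by fewer triangles than the star of
x contains (polygon_filling, short_link_filling), and exchanging the star for
this filling would lower the area.  So in a sweep of least area all total
angles are at least 2, and the balance of the Gauss-Bonnet formula never
decreases along the sweep (sweep_balance).  The exchange takes place in the
middle of the sweep; it is made possible by the invariant tracked, which says
what the swept area becomes when swept stars are given back.

The area of s is the least number of triangles in any contraction, spurs being
inserted and deleted at will (the predicate fill).  That a contraction of least
area can be chosen to be a sweep, and to start with the edges of s, is the
planarity behind van Kampen's lemma.  It is proved for words in an alphabet
with relations f = gh: a fillable word is a cactus, that is, words each letter
of which can be pushed across a triangle, joined by bridges (fill_cactus,
fill_peel, fill_step).

Topology enters in three places.  Simple connectedness gives a contraction of
every closed edge walk, by a grid fine enough for each of its cells to be
mapped into an open star (simply_connected_fillable).  A polygon without chords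
in a link has a realization homeomorphic to the circle, so that largeness of
the link applies to it (polygon_circle, full_cycle_walk_len).  A complex
homeomorphic to the circle has no triangle and contains a simple closed edge
walk (circle_no_triangle, circle_graph_cycle).

For the main statement, a full cycle of X contains such a closed walk s, and no
triangle of X contains two successive edges of s, since by fullness it would be
a triangle of the cycle.  Hence the cycle has length at least 2.  Three
pairwise adjacent vertices span a triangle, as their perimeter is at most 3/2,
and larger cliques span simplices because links are flag. *)

Import Order.TTheory GRing.Theory Num.Theory.
Import numFieldNormedType.Exports.
Set Implicit Arguments.
Unset Strict Implicit.
Unset Printing Implicit Defensive.

(** * Fillings of words, and cacti *)

Lemma cat_consP (T : Type) (P1 Q1 P2 Q2 : seq T) (x : T) :
  P1 ++ x :: Q1 = P2 ++ Q2 ->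
  (exists U, P2 = P1 ++ x :: U /\ Q1 = U ++ Q2) \/
  (exists U, P1 = P2 ++ U /\ Q2 = U ++ x :: Q1).
Proof.
elim: P1 P2 => [|y P1 IH] [|z P2] /=.
- by move=> <-; right; exists [::].
- by case=> <- ->; left; exists P2.
- by move=> <-; right; exists (y :: P1).
- case=> <- /IH[[U [-> ->]]|[U [-> ->]]]; first by left; exists U.
  by right; exists U.
Qed.

Section Filling.
Variables (A : eqType) (inv : A -> A) (rel : A -> A -> A -> Prop).
Hypothesis invK : involutive inv.
Hypothesis relL : forall f g h, rel f g h -> rel g f (inv h).
Hypothesis relR : forall f g h, rel f g h -> rel h (inv g) f.

(** [rel f g h] stands for the relation f = gh, so that n bounds the number of relators
needed to trivialize the word.  Insertion and deletion of spurs are free, which makes the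
least such n depend only on the class of the word in the free group. *)
Inductive fill : seq A -> nat -> Prop :=
| fill_nil n : fill [::] n
| fill_spur P d Q n : fill (P ++ Q) n -> fill (P ++ d :: inv d :: Q) n
| fill_unspur P d Q n : fill (P ++ d :: inv d :: Q) n -> fill (P ++ Q) n
| fill_rel P f g h Q n : rel f g h -> fill (P ++ g :: h :: Q) n ->
    fill (P ++ f :: Q) n.+1.

Lemma fill_weak w n m : n <= m -> fill w n -> fill w m.
Proof.
move=> nm; rewrite -(subnK nm) addnC; elim: (m - n) => [|k IH] H; first by rewrite addn0.
rewrite addnS; move/IH: H => {IH}; elim=> [p|P d Q p _ IH|P d Q p _ IH|P f g h Q p r _ IH].
- exact: fill_nil.
- exact: fill_spur.
- exact: fill_unspur IH.
- exact: fill_rel r IH.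
Qed.

(** A trivial word may be inserted anywhere, even at places where spurs would separate it
from its own letters: this is how discs are glued at a vertex. *)
Lemma fill_insert R m P Q n :
  fill R m -> fill (P ++ Q) n -> fill (P ++ R ++ Q) (n + m).
Proof.
move=> HR; elim: HR P Q n => {R m} [m|R1 d R2 m _ IH|R1 d R2 m _ IH|R1 f g h R2 m r _ IH] P Q n H.
- by apply: fill_weak H; rewrite leq_addr.
- rewrite -catA /= catA; apply: fill_spur.
  by move: (IH _ _ _ H); rewrite !catA.
- move: (IH _ _ _ H); rewrite -!catA /= !catA -!(catA _ R2).
  exact: fill_unspur.
- rewrite addnS -catA catA /=; apply: fill_rel r _.
  by move: (IH _ _ _ H); rewrite -!catA.
Qed.

Lemma fill_unrel P f g h Q n :
  rel f g h -> fill (P ++ f :: Q) n -> fill (P ++ g :: h :: Q) n.+1.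
Proof.
move=> r H; apply: (fill_rel (relL r)).
rewrite -cat_rcons -[h in _ :: h :: _]invK; apply: fill_spur; by rewrite cat_rcons.
Qed.

Lemma fill_remove R m P Q n :
  fill R m -> fill (P ++ R ++ Q) n -> fill (P ++ Q) (n + m).
Proof.
move=> HR; elim: HR P Q n => {R m} [m|R1 d R2 m _ IH|R1 d R2 m _ IH|R1 f g h R2 m r _ IH] P Q n H.
- by apply: fill_weak H; rewrite leq_addr.
- apply: IH; move: H; rewrite -!catA /= !catA -!(catA _ R2); exact: fill_unspur.
- apply: IH; rewrite -!catA /= catA; apply: fill_spur.
  by move: H; rewrite -!catA.
- rewrite addnS -addSn; apply: IH; move: H; rewrite -!catA /= !(catA P).
  exact: fill_unrel.
Qed.

Lemma fill_word_inv R : fill (R ++ rev (map inv R)) 0.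
Proof.
elim/last_ind: R => [|R d IH]; first exact: fill_nil.
by rewrite map_rcons rev_rcons cat_rcons; apply: fill_spur.
Qed.

Lemma fill_inv_word R : fill (rev (map inv R) ++ R) 0.
Proof.
by have := fill_word_inv (rev (map inv R)); rewrite map_rev revK (mapK invK).
Qed.

(** Conjugation: PQ is inserted between P^-1 and P, and P^-1 P is then removed. *)
Lemma fill_rot P Q n : fill (P ++ Q) n -> fill (Q ++ P) n.
Proof.
move=> H.
have /(fill_insert H) : fill (rev (map inv P) ++ P) 0 by exact: fill_inv_word.
rewrite add0n -!catA catA => /(fill_remove (P := [::]) (fill_inv_word P)).
by rewrite addn0.
Qed.

(** A boundary word of a disc without bridges: every letter f is a side of a triangle of the
disc, whose removal replaces f by the two other sides and leaves area m - 1. *)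
Definition peelable r m := fill r m /\
  forall P f Q, r = P ++ f :: Q ->
    exists g h k, [/\ rel f g h, m = k.+1 & fill (P ++ g :: h :: Q) k].

Lemma peelable_nil m : peelable [::] m.
Proof. by split=> [|[|? ?] ? ?] //; exact: fill_nil. Qed.

Lemma peelable_insert P Q R n m :
  peelable (P ++ Q) n -> peelable R m -> peelable (P ++ R ++ Q) (n + m).
Proof.
move=> [f1 g1] [f2 g2]; split=> [|S f T]; first exact: fill_insert.
move=> /esym E; case: (cat_consP E) => {E} [[U [EP ET]]|[U [ES]]].
- move: EP ET g1 => -> -> /(_ S f (U ++ Q)); rewrite -catA => /(_ erefl).
  move=> [g [h [k [r -> H]]]]; exists g, h, (k + m); split=> //.
  have := @fill_insert R m (S ++ g :: h :: U) Q k f2; rewrite -!catA /=; exact.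
- rewrite ES; move=> /esym E; case: (cat_consP E) => {E} [[U' [ER ->]]|[U' [-> EQ]]].
  + have [g [h [k [r Em H]]]] := g2 _ _ _ ER.
    exists g, h, (n + k); rewrite Em addnS; split=> //.
    by have := fill_insert H f1; rewrite -!catA.
  + have := g1 (P ++ U') f T; rewrite EQ -!catA => /(_ erefl).
    move=> [g [h [k [r -> H]]]]; exists g, h, (k + m); split=> //.
    by move: H; rewrite -catA => /(fill_insert f2); rewrite -!catA.
Qed.

Lemma peelable_unspur P d Q m : peelable (P ++ d :: inv d :: Q) m -> peelable (P ++ Q) m.
Proof.
move=> [f1 g1]; split=> [|S f T]; first exact: fill_unspur f1.
move=> /esym E; case: (cat_consP E) => {E} [[U [EP ET]]|[U [ES EQ]]].
- move: EP ET g1 => -> -> /(_ S f (U ++ d :: inv d :: Q)); rewrite -catA /= => /(_ erefl).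
  move=> [g [h [k [r -> H]]]]; exists g, h, k; split=> //.
  by move: H; rewrite -!cat_cons catA => /fill_unspur; rewrite -catA.
- have := g1 (P ++ d :: inv d :: U) f T; rewrite EQ -!catA /= => /(_ erefl).
  move=> [g [h [k [r -> H]]]]; exists g, h, k; split=> //.
  by rewrite ES -catA; move: H; rewrite -catA; exact: fill_unspur.
Qed.

Lemma peelable_rot P Q m : peelable (P ++ Q) m -> peelable (Q ++ P) m.
Proof.
move=> [f1 g1]; split=> [|S f T]; first exact: fill_rot.
move=> /esym E; case: (cat_consP E) => {E} [[U [EQ ET]]|[U [ES EP]]].
- have := g1 (P ++ S) f U; rewrite EQ -catA => /(_ erefl).
  move=> [g [h [k [r -> H]]]]; exists g, h, k; split=> //.
  by move: H; rewrite -catA => /fill_rot; rewrite ET -!catA.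
- have := g1 U f (T ++ Q); rewrite EP -catA => /(_ erefl).
  move=> [g [h [k [r -> H]]]]; exists g, h, k; split=> //.
  rewrite ES -catA; apply: fill_rot; by rewrite -catA.
Qed.

Lemma peelable_triangle f g h : rel f g h -> peelable [:: f; inv h; inv g] 1.
Proof.
move=> r.
have fg : fill [:: g; h; inv h; inv g] 0.
  by apply: (@fill_spur [:: g] h [:: inv g]); apply: (@fill_spur [::] g [::]); exact: fill_nil.
split; first exact: (@fill_rel [::] f g h _ 0 r).
move=> [|a [|b [|c P]]] x Q //=.
- by case=> <- <-; exists g, h, 0.
- case=> <- <- <-; exists (inv f), g, 0; split=> //.
    exact: relR (relL r).
  by apply: (@fill_spur [::] f [:: g; inv g]); apply: (@fill_spur [::] g [::]); exact: fill_nil.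
- case=> <- <- <- <-; exists h, (inv f), 0; split=> //.
    exact: relL (relR r).
  have := @fill_spur [:: f] (inv h) [:: inv f] 0; rewrite invK; apply.
  by apply: (@fill_spur [::] f [::]); exact: fill_nil.
- by case: P.
Qed.

(** [cactus r w n]: reading w, a bracket [d w' d^-1] is a bridge leading to another cactus w',
and the letters outside the brackets form the word r.  The number n counts the area of the
discs beyond the bridges; that of r itself is not included, because r is the word that
changes when bridges are deleted. *)
Inductive cactus : seq A -> seq A -> nat -> Prop :=
| cactus_nil : cactus [::] [::] 0
| cactus_letter f r w n : cactus r w n -> cactus (f :: r) (f :: w) n
| cactus_bridge d r' w' n' m' r w n :
    cactus r' w' n' -> peelable r' m' -> cactus r w n ->
    cactus r (d :: w' ++ inv d :: w) (n' + m' + n).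

Lemma cactus_cat r1 w1 n1 r2 w2 n2 :
  cactus r1 w1 n1 -> cactus r2 w2 n2 -> cactus (r1 ++ r2) (w1 ++ w2) (n1 + n2).
Proof.
move=> H1 H2; elim: H1 => {r1 w1 n1} [|f r w n _ IH|d r' w' n' m' r w n H' _ g _ IH] //=.
- exact: cactus_letter.
- by rewrite -catA cat_cons -addnA; exact: cactus_bridge H' g IH.
Qed.

Lemma cactus_fill r w n P Q m :
  cactus r w n -> fill (P ++ r ++ Q) m -> fill (P ++ w ++ Q) (n + m).
Proof.
move=> H; elim: H P Q m => {r w n} [|f r w n _ IH|d r' w' n' m' r w n _ IH' [f' _] _ IH] P Q m //=.
- by rewrite -!cat_rcons; exact: IH.
- move/IH => H; have Hw' : fill w' (n' + m').
    by have := IH' [::] [::] m'; rewrite !cats0 /=; apply.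
  have := @fill_insert w' _ (rcons P d) (inv d :: w ++ Q) (n + m) Hw'.
  rewrite !cat_rcons -catA cat_cons => /(_ (fill_spur _ H)).
  by apply: fill_weak; lia.
Qed.

(** A bridge can be planted anywhere, also inside the part beyond another bridge. *)
Lemma cactus_insert_bridge r w n P Q d ri wi ni mi :
  cactus r w n -> w = P ++ Q -> cactus ri wi ni -> peelable ri mi ->
  cactus r (P ++ d :: wi ++ inv d :: Q) (ni + mi + n).
Proof.
move=> H E Hi gi.
elim: H P Q E => {r w n} [|f r w n H IH|e r' w' n' m' r w n H' IH' g H IH] [|x P] Q //=.
- by move=> <-; exact: cactus_bridge Hi gi cactus_nil.
- by move=> <-; apply: cactus_bridge Hi gi _; exact: cactus_letter.
- by case=> <- /IH Hw; exact: cactus_letter.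
- by move=> <-; apply: cactus_bridge Hi gi _; exact: cactus_bridge H' g H.
- case=> <- E; case: (cat_consP E) => [[U [-> EU]]|[U [EU ->]]].
  + rewrite addnCA -catA cat_cons; apply: cactus_bridge H' g _; exact: IH.
  + have -> : ni + mi + (n' + m' + n) = (ni + mi + n') + m' + n by lia.
    have := cactus_bridge e (IH' _ _ EU) g H.
    by rewrite -!catA /= -!catA.
Qed.

(** The first letter of a cactus is a letter of its own disc or the start of a bridge. *)
Lemma cactus_head r x w n : cactus r (x :: w) n ->
  (exists2 r1, r = x :: r1 & cactus r1 w n) \/
  (exists u v ri ni mi n2, [/\ w = u ++ inv x :: v, cactus ri u ni, peelable ri mi,
     cactus r v n2 & n = ni + mi + n2]).
Proof.
move E: (x :: w) => xw H; case: H E => {r xw n} [|f r u n H|d r' w' n' m' r u n H' g H] //.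
- by case=> -> ->; left; exists r.
- by case=> -> ->; right; exists w', u, r', n', m', n.
Qed.

Lemma cactus_nilP r n : cactus r [::] n -> r = [::] /\ n = 0.
Proof. by move E: [::] => w H; case: H E. Qed.

Lemma cactus_last r x w n : cactus r (rcons w x) n ->
  (exists2 r1, r = rcons r1 x & cactus r1 w n) \/
  (exists u v ri ni mi n1, [/\ w = u ++ inv x :: v, cactus ri v ni, peelable ri mi,
     cactus r u n1 & n = ni + mi + n1]).
Proof.
move E: (rcons w x) => wx H.
elim: H w E => {r wx n} [|f r u n H IH|d r' w' n' m' r u n H' _ g H IH] w E.
- by case: w E.
- case: w E => [[-> E]|y w [-> /IH]].
    case: u H {IH} E => // /cactus_nilP[-> ->] _; left; exists [::] => //.
    exact: cactus_nil.
  case=> [[r1 -> H1]|[u' [v [ri [ni [mi [n1 [-> H1 g1 H2 ->]]]]]]]].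
    by left; exists (f :: r1) => //; exact: cactus_letter.
  right; exists (f :: u'), v, ri, ni, mi, n1; split=> //; exact: cactus_letter.
- case/lastP: u H IH E => [|u y] H IH.
  + rewrite -cat_cons cats1 => E'; case: (rcons_inj E') => ? ?; subst w x.
    case/cactus_nilP: H => -> ->; right; exists [::], w', r', n', m', 0.
    by rewrite invK; split=> //; exact: cactus_nil.
  + rewrite -rcons_cons -rcons_cat -rcons_cons => E'; case: (rcons_inj E') => ? ?; subst w y.
    case: (IH u erefl) => [[r1 -> H1]|[u' [v [ri [ni [mi [n1 [-> H1 g1 H2 ->]]]]]]]].
      by left; exists r1 => //; exact: cactus_bridge H' g H1.
    right; exists (d :: w' ++ inv d :: u'), v, ri, ni, mi, (n' + m' + n1).
    by split=> //; [rewrite /= -catA|exact: cactus_bridge H' g H2|lia].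
Qed.

(** The discs that move from behind a bridge into the word r bring their area with them.  The
prefix r0 makes the notion stable under adding letters in front of r. *)
Definition absorbs r n r' n' := forall r0 m, peelable (r0 ++ r) m ->
  exists2 m', peelable (r0 ++ r') m' & n' + m' <= n + m.

(** Gluing two adjacent sides d and d^-1 keeps the cactus form and the total area.  If
both are letters of one disc, they just disappear.  If one of them belongs to a bridge, the
bridge is used up: the disc behind it joins the disc before it at a vertex, and the partner
of the lost letter takes its place. *)
Lemma cactus_unspur r w n P d Q : cactus r w n -> w = P ++ d :: inv d :: Q ->
  exists r' n', cactus r' (P ++ Q) n' /\ absorbs r n r' n'.
Proof.
move=> H; elim: H P d Q => {r w n} [|f r w n H IH|d0 r' w' n' m' r w n H' IH' g H IH] [|x P] d Q //=.
- case=> Ef Ew; subst f w; case: (cactus_head H) => [[r1 E H1]|[u [v [ri [ni [mi [n2 [EQ Hi gi H2 ->]]]]]]]].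
  + exists r1, n; split=> // r0 m; rewrite E => /peelable_unspur gr.
    by exists m.
  + exists (ri ++ d :: r), (ni + n2); split.
      by rewrite EQ invK; apply: cactus_cat => //; exact: cactus_letter.
    by move=> r0 m gr; exists (m + mi); [exact: peelable_insert|lia].
- case=> <- /IH[r1 [n1 [H1 U]]]; exists (f :: r1), n1; split; first exact: cactus_letter.
  by move=> r0 m; rewrite -!cat_rcons; exact: U.
- case=> E0; subst d0; case: w' H' IH' => [H' _ [E2]|y w' H' _ [E1 E2]].
    exists r, n; subst Q; split=> // r0 m gr; exists m => //; lia.
  subst y Q; case: (cactus_head H') => [[r1 E H1]|[u [v [ri [ni [mi [n2 [EQ Hi gi H2 ->]]]]]]]].
  + exists (r1 ++ inv d :: r), (n' + n); split.
      by apply: cactus_cat => //; exact: cactus_letter.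
    move=> r0 m gr; exists (m + m'); last by lia.
    rewrite -cat_rcons -cats1; apply: peelable_insert => //.
    by apply: (@peelable_rot [:: inv d]); rewrite /= -E.
  + exists (ri ++ r), (ni + (n2 + m' + n)); rewrite EQ invK -catA cat_cons; split.
      by apply: cactus_cat => //; exact: cactus_bridge H2 g H.
    by move=> r0 m gr; exists (m + mi); [exact: peelable_insert|lia].
- case=> E0 E; subst x; case: (cat_consP E) => [[U [-> EU]]|[[|y [|z U]] [EU EQ]]].
  + have [r1 [n1 [H1 U1]]] := IH _ _ _ EU.
    exists r1, (n' + m' + n1); rewrite -catA cat_cons; split; first exact: cactus_bridge H' g H1.
    by move=> r0 m /U1[m1 g1 le]; exists m1 => //; lia.
  + case: EQ => Ed Ew; subst d w; rewrite cats0 in EU; subst w'.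
    rewrite invK in H; case: (cactus_head H) => [[r1 Er H1]|[u [v [ri [ni [mi [n2 [EQ Hi gi H2 ->]]]]]]]].
    * exists (d0 :: r' ++ r1), (n' + n); split.
        by apply: cactus_letter; exact: cactus_cat.
      move=> r0 m; rewrite Er -!cat_rcons => gr; exists (m + m'); last by lia.
      exact: peelable_insert.
    * exists r, (n' + ni + (m' + mi) + n2); split; last by move=> r0 m gr; exists m => //; lia.
      have gi' : peelable (r' ++ ri) (m' + mi).
        by rewrite -[ri]cats0; apply: peelable_insert; rewrite ?cats0.
      by rewrite EQ catA; exact: cactus_bridge (cactus_cat H' Hi) gi' H2.
  + case: EQ => Ed /(can_inj invK) Ed' EQ; subst y d0 w; rewrite cats1 in EU; subst w'.
    case: (cactus_last H') => [[r1 Er H1]|[u [v [ri [ni [mi [n1 [EP Hi gi H2 ->]]]]]]]].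
    * exists ((d :: r1) ++ r), (n' + n); split.
        by apply: cactus_letter; exact: cactus_cat.
      move=> r0 m gr; exists (m + m'); last by lia.
      apply: peelable_insert => //.
      by rewrite -cat1s; apply: peelable_rot; rewrite cats1 -Er.
    * exists (ri ++ r), (n1 + m' + (ni + n)); rewrite EP -catA cat_cons; split.
        by apply: cactus_bridge H2 g _; exact: cactus_cat.
      by move=> r0 m gr; exists (m + mi); [exact: peelable_insert|lia].
  + case: EQ => Ed Ed' EQ; subst y z Q.
    have [r1 [n1 [H1 U1]]] := IH' _ _ _ EU.
    have [m1 g1 le] := U1 [::] _ g.
    exists r, (n1 + m1 + n); split; last by move=> r0 m gr; exists m => //; lia.
    by rewrite catA; exact: cactus_bridge H1 g1 H.
Qed.

Definition cactus_filling w n :=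
  exists r k m, [/\ cactus r w k, peelable r m & k + m <= n].

(** The area bookkeeping of [cactus_unspur], for a cactus that is not part of a larger one. *)
Lemma cactus_filling_unspur P d Q n :
  cactus_filling (P ++ d :: inv d :: Q) n -> cactus_filling (P ++ Q) n.
Proof.
move=> [r [k [m [H g le]]]].
have [r' [k' [H' /(_ [::] _ g)[m' g' le']]]] := cactus_unspur H erefl.
by exists r', k', m'; split=> //; lia.
Qed.

(** Van Kampen's lemma.  Pushing a letter is reduced to planting a triangle on a bridge and
to deleting three spurs. *)
Lemma fill_cactus w n : fill w n -> cactus_filling w n.
Proof.
elim=> {w n} [n|P d Q n _ IH|P d Q n _ IH|P f g h Q n rl _ [r [k [m [H gr le]]]]].
- by exists [::], 0, 0; split=> //; [exact: cactus_nil|exact: peelable_nil].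
- have [r [k [m [H g le]]]] := IH; exists r, (0 + 0 + k), m; split=> //.
  exact: (cactus_insert_bridge d H erefl cactus_nil (peelable_nil 0)).
- exact: cactus_filling_unspur IH.
- have Ht : cactus [:: inv h; inv g; f] [:: inv h; inv g; f] 0.
    by do 3 apply: cactus_letter; exact: cactus_nil.
  have tg : peelable [:: inv h; inv g; f] 1 := @peelable_rot [:: f] _ _ (peelable_triangle rl).
  (* P g h Q becomes P f (h^-1 g^-1 f) f^-1 g h Q, whose spurs are deleted in turn. *)
  have H0 := cactus_insert_bridge f H erefl Ht tg.
  have {H0} : cactus_filling (rcons (rcons (rcons P f) (inv h)) (inv g) ++
      f :: inv f :: g :: h :: Q) n.+1.
    by exists r, (0 + 1 + k), m; rewrite !cat_rcons; split=> //; lia.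
  move/cactus_filling_unspur; rewrite cat_rcons -{2}(invK g).
  move/cactus_filling_unspur; rewrite cat_rcons -{2}(invK h).
  by move/cactus_filling_unspur; rewrite cat_rcons.
Qed.

Definition peels P f Q n := exists g h k,
  [/\ rel f g h, n = k.+1 & fill (P ++ g :: h :: Q) k].

(** A letter whose inverse does not occur cannot be the side of a bridge. *)
Lemma cactus_peel r w n r0 m P f Q :
  cactus r w n -> peelable (r0 ++ r) m -> w = P ++ f :: Q -> inv f \notin w ->
  peels (r0 ++ P) f Q (n + m).
Proof.
move=> H; elim: H r0 m P f Q => {r w n} [|e r w n H IH|d r' w' n' m' r w n H' IH' g H IH] r0 m [|x P] f Q gr //.
- case=> <- <- _.
  have [a [b [k [rl Em Hk]]]] := gr.2 _ _ _ erefl.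
  exists a, b, (n + k); split=> //; first by rewrite Em addnS.
  by have := @cactus_fill _ _ _ (r0 ++ [:: a; b]) [::] k H; rewrite !cats0 -!catA; apply.
- case=> E Ew; subst x; rewrite inE negb_or => /andP[_ nf].
  by rewrite -cat_rcons; apply: IH Ew nf; rewrite cat_rcons.
- by case=> -> _; rewrite inE mem_cat inE eqxx !orbT.
- case=> <- E; rewrite inE mem_cat inE !negb_or => /and4P[nd nf1 _ nf2].
  have Hw : fill (r0 ++ w) (n + m).
    by have := @cactus_fill _ _ _ r0 [::] m H; rewrite !cats0; apply; exact: gr.1.
  have Hw' : fill w' (n' + m').
    by have := @cactus_fill _ _ _ [::] [::] m' H'; rewrite !cats0 /=; apply; exact: g.1.
  case: (cat_consP E) => [[U [EP EU]]|[[|y U] [EU EQ]]].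
  + have [a [b [k [rl Em Hk]]]] := IH _ _ _ _ _ gr EU nf2.
    exists a, b, (k + (n' + m')); split=> //; first by rewrite -addnA Em; lia.
    have := @fill_insert w' _ (rcons r0 d) (inv d :: U ++ a :: b :: Q) k Hw'.
    rewrite !cat_rcons EP -!catA /= -!catA; apply; apply: fill_spur.
    by rewrite catA.
  + by case: EQ nd => -> _; rewrite invK eqxx.
  + case: EQ => Ey EQ; subst y Q.
    have [a [b [k [rl Em Hk]]]] := IH' [::] _ _ _ _ g EU nf1.
    exists a, b, (n + m + k); split=> //; first by rewrite Em; lia.
    have := fill_insert (P := rcons r0 d) Hk (_ : fill (_ ++ inv d :: w) (n + m)).
    rewrite !cat_rcons -!catA /=; apply; exact: fill_spur.
Qed.

(** In a filling, a letter is the side of a triangle unless both of its sides are exposed,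
and then its inverse occurs in the word. *)
Lemma fill_peel P f Q n :
  fill (P ++ f :: Q) n -> inv f \notin P ++ f :: Q -> peels P f Q n.
Proof.
move=> /fill_cactus[r [k [m [H g le]]]] nf.
have [a [b [j [rl E Hj]]]] := cactus_peel (r0 := [::]) H g erefl nf.
exists a, b, n.-1; split=> //; first by lia.
by apply: fill_weak Hj; lia.
Qed.

(** Either the first letter of the word belongs to a disc, or it starts a bridge; what lies
behind the bridge is then shorter, or empty and the bridge is a spur. *)
Lemma cactus_step r w n m : cactus r w n -> peelable r m -> w != [::] ->
  (exists P d Q, w = P ++ d :: inv d :: Q) \/
  (exists P f Q, w = P ++ f :: Q /\ peels P f Q (n + m)).
Proof.
move=> H; elim: H m => {r w n} [|e r w n H _|d r' w' n' m' r w n H' IH' g H _] m gr //= _.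
- right; have [a [b [k [rl Em Hk]]]] := gr.2 [::] _ _ erefl.
  exists [::], e, w; split=> //; exists a, b, (n + k); split=> //; first by rewrite Em addnS.
  by have := @cactus_fill _ _ _ [:: a; b] [::] k H; rewrite !cats0; apply.
- have [->|/(IH' _ g)] := eqVneq w' [::]; first by left; exists [::], d, w.
  case=> [[P [e [Q ->]]]|[P [f [Q [-> [a [b [k [rl E Hk]]]]]]]]].
    by left; exists (d :: P), e, (Q ++ inv d :: w); rewrite /= -catA.
  right; exists (d :: P), f, (Q ++ inv d :: w); split; first by rewrite /= -catA.
  have Hw : fill w (n + m).
    by have := @cactus_fill _ _ _ [::] [::] m H; rewrite !cats0; apply; exact: gr.1.
  exists a, b, (n + m + k); split=> //; first by rewrite E; lia.
  have := fill_insert (P := [:: d]) Hk (_ : fill (_ ++ inv d :: w) (n + m)).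
  rewrite -!catA /=; apply; exact: (@fill_spur [::]).
Qed.

(** Contraction can proceed by deleting spurs and pushing letters, never inserting spurs. *)
Lemma fill_step w n : fill w n -> w != [::] ->
  (exists P d Q, w = P ++ d :: inv d :: Q) \/
  (exists P f Q, w = P ++ f :: Q /\ peels P f Q n).
Proof.
move=> /fill_cactus[r [k [m [H g le]]]] w0.
have [?|[P [f [Q [E [a [b [j [rl Ej Hj]]]]]]]]] := cactus_step H g w0; first by left.
right; exists P, f, Q; split=> //; exists a, b, n.-1; split=> //; first by lia.
by apply: fill_weak Hj; lia.
Qed.
End Filling.

Local Open Scope ring_scope.

(** * Edge walks, their fillings and sweeps *)

Section Words.
Variables (V : choiceType).

Definition swap (f : V * V) := (f.2, f.1).
Lemma swapK : involutive swap. Proof. by case. Qed.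

(** Repeated vertices contribute no letter, so that degenerate walks, such as the rows of a grid
labelled by vertices, are words as well. *)
Fixpoint word (a : V) (s : seq V) : seq (V * V) :=
  if s is b :: s' then (if a == b then [::] else [:: (a, b)]) ++ word b s' else [::].
Definition darts (s : seq V) := if s is a :: s' then word a s' else [::].

Lemma word_cat a s t : word a (s ++ t) = word a s ++ word (last a s) t.
Proof. by elim: s a => [|b s IH] a //=; rewrite IH catA. Qed.

Lemma darts_cat A c B : darts (A ++ c :: B) = darts (rcons A c) ++ darts (c :: B).
Proof. by case: A => [|a A] //=; rewrite -cat_rcons word_cat last_rcons. Qed.

Lemma darts_split s P u v Q : sorted (fun a b => a != b) s ->
  darts s = P ++ (u, v) :: Q ->
  exists A B, [/\ s = A ++ u :: v :: B, P = darts (rcons A u) & Q = darts (v :: B)].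
Proof.
elim: s P => [|a [|b s] IH] P; [by case: P..|].
move=> /= /andP[ab p]; rewrite (negPf ab) /=; case: P => [|f P] /= [].
  by move=> <- <- <-; exists [::], s.
move=> <- /(IH _ p)[A [B [Es -> ->]]].
exists (a :: A), B; split=> //=; first by rewrite Es.
by case: A Es => [|a' A] [<- _] /=; rewrite (negPf ab).
Qed.

Lemma darts_head s c d P : sorted (fun a b => a != b) (c :: s) ->
  darts (c :: s) = (c, d) :: P -> exists s', s = d :: s'.
Proof. by case: s => [|b s] //= /andP[/negPf -> _] /= [-> _]; exists s. Qed.

Variable X : complex V.

Definition triangle a b c := [/\ a != b, b != c, c != a & X [fset a; b; c]%fset].

Lemma triangle_rot a b c : triangle a b c -> triangle b c a.
Proof. by case=> ab bc ca H; split=> //; rewrite fsetUC fsetUA. Qed.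

Lemma triangle_flip a b c : triangle a b c -> triangle b a c.
Proof.
case=> ab bc ca H; split; rewrite 1?eq_sym //.
by rewrite (fsetUC [fset b]%fset).
Qed.

(** The relation ab = (ax)(xb) given by a triangle. *)
Definition across (f g h : V * V) :=
  [/\ g.1 = f.1, g.2 = h.1, h.2 = f.2 & triangle f.1 f.2 g.2].

Lemma acrossL f g h : across f g h -> across g f (swap h).
Proof.
move=> [E1 E2 E3 t]; split=> //=; rewrite E1.
by apply/triangle_rot/triangle_flip.
Qed.

Lemma acrossR f g h : across f g h -> across h (swap g) f.
Proof.
move=> [E1 E2 E3 t]; split=> //=; rewrite -E2 E3 E1.
by apply/triangle_rot/triangle_rot/triangle_flip.
Qed.

Definition filling s n := fill swap across (darts s) n.

Lemma filling_weak s n m : (n <= m)%N -> filling s n -> filling s m.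
Proof. exact: fill_weak. Qed.

Lemma filling_fold A c b B n : filling (A ++ c :: B) n <-> filling (A ++ c :: b :: c :: B) n.
Proof.
rewrite /filling darts_cat (darts_cat A c (b :: _)) /= (eq_sym b).
by case: eqP => //= _; split=> [|/fill_unspur]; [exact: (@fill_spur _ swap)|].
Qed.

Lemma triangle_across a b x : triangle a b x -> across (a, b) (a, x) (x, b).
Proof. by []. Qed.

Lemma filling_push A a x b B n : triangle a b x ->
  filling (A ++ a :: x :: b :: B) n -> filling (A ++ a :: b :: B) n.+1.
Proof.
move=> t; rewrite /filling !(darts_cat A a) /=; case: (t) => ab bx xa _.
rewrite (negPf ab) (eq_sym a) (negPf xa) (eq_sym x) (negPf bx) /=.
exact: (fill_rel (triangle_across t)).
Qed.

Lemma filling_pull A a x b B n : triangle a b x ->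
  filling (A ++ a :: b :: B) n -> filling (A ++ a :: x :: b :: B) n.+1.
Proof.
move=> t; rewrite /filling !(darts_cat A a) /=; case: (t) => ab bx xa _.
rewrite (negPf ab) (eq_sym a) (negPf xa) (eq_sym x) (negPf bx) /=.
exact: (fill_unrel swapK acrossL (triangle_across t)).
Qed.

Lemma filling_insert (A : seq V) c (p B : seq V) n m :
  filling (c :: rcons p c) m -> filling (A ++ c :: B) n ->
  filling (A ++ c :: p ++ c :: B) (n + m).
Proof.
move=> H; rewrite /filling darts_cat => /(fill_insert H).
by rewrite (darts_cat A c (p ++ _)) -[c :: p ++ _]/((c :: p) ++ _) (darts_cat (c :: p)) !catA.
Qed.

(** A contraction of a walk that inserts no spur.  Every position other than those of the
initial walk is born in a push and disappears in a fold. *)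
Inductive sweep : seq V -> nat -> Prop :=
| sweep_point v n : sweep [:: v] n
| sweep_fold A c b B n : sweep (A ++ c :: B) n -> sweep (A ++ c :: b :: c :: B) n
| sweep_push A a x b B n : triangle a b x ->
    sweep (A ++ a :: x :: b :: B) n -> sweep (A ++ a :: b :: B) n.+1.

Lemma sweep_filling s n : sweep s n -> filling s n.
Proof.
elim=> {s n} [v n|A c b B n _|A a x b B n t _]; first exact: fill_nil.
- by rewrite -filling_fold.
- exact: filling_push.
Qed.

Lemma sorted_neq_fold (A : seq V) c b B : sorted (fun a b => a != b) (A ++ c :: b :: c :: B) ->
  sorted (fun a b => a != b) (A ++ c :: B).
Proof.
by case: A => [|a A] /=; [case/and3P|rewrite !cat_path /= => /and5P[-> -> _ _ ->]].
Qed.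

Lemma sorted_neq_push A a x b B : triangle a b x -> sorted (fun a b => a != b) (A ++ a :: b :: B) ->
  sorted (fun a b => a != b) (A ++ a :: x :: b :: B).
Proof.
case=> ab bx xa _; case: A => [|y A] /=; rewrite ?cat_path /= (eq_sym a x) xa (eq_sym x) bx.
  by case/andP.
by case/and4P=> -> -> _ ->.
Qed.

(** The number 2n + size s decreases: a push costs a triangle and adds one vertex, a fold
removes two vertices. *)
Lemma filling_sweep s n : s != [::] -> sorted (fun a b => a != b) s -> filling s n -> sweep s n.
Proof.
have [m] := ubnP (n + n + size s)%N; elim: m s n => [|m IH] // s n le s0 ps H.
have [w0|w0] := eqVneq (darts s) [::].
  case: s s0 ps w0 {le H} => [|a [|b s]] //= _; first by move=> _ _; exact: sweep_point.
  by case/andP=> /negPf ->.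
case: (fill_step swapK acrossL acrossR H w0) => [[P [[u v] [Q E]]]|[P [[a b] [Q [E [g [h [k [r En Hk]]]]]]]]].
- have [A [B [Es EP EB]]] := darts_split ps E; subst s.
  have : darts (v :: B) = (v, u) :: Q by rewrite -EB.
  have pB : sorted (fun a b => a != b) (v :: B).
    by move: ps; rewrite -cat_rcons; case: (rcons A u) => [|y A'] //=; rewrite cat_path => /and3P[].
  case/(darts_head pB) => B' EB'; subst B.
  apply/sweep_fold/IH.
  + by move: le; rewrite !size_cat /=; lia.
  + by case: (A).
  + exact: sorted_neq_fold ps.
  + by rewrite filling_fold; exact: H.
- have [A [B [Es EP EB]]] := darts_split ps E; subst s n.
  case: g h r Hk => [a' x] [x' b'] /= [/= -> <- -> t] Hk.
  apply: (sweep_push t); apply: IH.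
  + by move: le; rewrite !size_cat /=; lia.
  + by case: (A).
  + exact: sorted_neq_push.
  + move: Hk; rewrite EP EB /filling (darts_cat A) /=; case: (t) => ab bx xa _.
    by rewrite (eq_sym a) (negPf xa) (eq_sym x) (negPf bx).
Qed.

End Words.

(** * Gauss-Bonnet along a sweep of least area *)

Section Chain.
Variables (T : Type) (r : T -> T -> Prop).
Fixpoint chain (a : T) (s : seq T) : Prop :=
  if s is b :: s' then r a b /\ chain b s' else True.
Lemma chain_cat a s t : chain a (s ++ t) <-> chain a s /\ chain (last a s) t.
Proof. by elim: s a => [|b s IH] a /=; [tauto|rewrite IH; tauto]. Qed.
Lemma chain_rcons a s x : chain a (rcons s x) <-> chain a s /\ r (last a s) x.
Proof. by rewrite -cats1 chain_cat /=; tauto. Qed.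
End Chain.

Section GaussBonnet.
Variables (R : realType) (V : choiceType) (X : length_complex R V).

Definition edge_len (a b : V) : R := len X [fset a; b]%fset.
Lemma edge_lenC a b : edge_len a b = edge_len b a. Proof. by rewrite /edge_len fsetUC. Qed.

Fixpoint path_len (a : V) (s : seq V) : R :=
  if s is b :: s' then edge_len a b + path_len b s' else 0.
Lemma path_len_cat a s t : path_len a (s ++ t) = path_len a s + path_len (last a s) t.
Proof. by elim: s a => [|b s IH] a /=; rewrite ?add0r // IH addrA. Qed.
Lemma path_len_rcons a s x : path_len a (rcons s x) = path_len a s + edge_len (last a s) x.
Proof. by rewrite -cats1 path_len_cat /= addr0. Qed.

Lemma simplex_sub (Y : complex V) s a : Y s -> a \in s -> Y [fset a]%fset.
Proof.
move=> Ys sa; apply: simplex_face Ys _ _; last by rewrite fsub1set.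
by apply/fset0Pn; exists a; rewrite inE.
Qed.

Lemma simplex_sub2 (Y : complex V) s a b : Y s -> a \in s -> b \in s -> Y [fset a; b]%fset.
Proof.
move=> Ys sa sb; apply: simplex_face Ys _ _.
  by apply/fset0Pn; exists a; rewrite !inE eqxx.
by apply/fsubsetP => x; rewrite !inE => /orP[]/eqP->.
Qed.

Lemma edge_pair (Y : complex V) a b : a != b -> Y [fset a; b]%fset -> edge Y [fset a; b]%fset.
Proof. by move=> ab Yab; split=> //; rewrite cardfs2 ab. Qed.

Lemma edge_len_bounds a b : a != b -> X [fset a; b]%fset -> 0 <= edge_len a b <= 2^-1.
Proof. by move=> ab Xab; apply: (lenP X).1; apply: edge_pair. Qed.

Lemma triangle_edge (Y : complex V) a b c : triangle Y a b c -> Y [fset a; b]%fset.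
Proof. by case=> _ _ _ H; apply: simplex_sub2 H _ _; rewrite !inE eqxx ?orbT. Qed.

Lemma triangle_ge0 a b c : triangle X a b c -> 0 <= edge_len a b.
Proof.
move=> t; case: (t) => ab _ _ _.
by have /andP[] := edge_len_bounds ab (triangle_edge t).
Qed.

Lemma triangle_le1 a b c : triangle X a b c -> edge_len a b + edge_len b c + edge_len c a <= 1.
Proof. by case=> ab bc ca H; have [] := (lenP X).2 a b c ab bc ca H. Qed.

Lemma chain_path_len_ge0 x a s : chain (triangle X x) a s -> 0 <= path_len a s.
Proof.
elim: s a => [|b s IH] a //= [t /IH H]; apply: addr_ge0 => //.
exact: triangle_ge0 (triangle_rot t).
Qed.

Notation pos := (V * option (seq V))%type.
Definition labels (st : seq pos) := map fst st.

Lemma labels_cat A B : labels (A ++ B) = labels A ++ labels B.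
Proof. exact: map_cat. Qed.

(** The state of a sweep lists the positions of the current walk.  A position of the initial
walk carries None.  A position born in a push carries Some p, where p lists the interior
vertices of the path in its link, from its predecessor to its successor, formed by the
triangles that the sweep has crossed; the length of this path is the angle swept at the
position.  With the vertices a and z before and after the list, [balance] is the sum of
1 - angle over the positions born in the sweep, and of -1 over those of the initial walk.
Gauss-Bonnet becomes the statement that it does not decrease. *)
Fixpoint balance (a : V) (st : seq pos) (z : V) : R :=
  if st is (x, o) :: B then
    (if o is Some p then 1 - path_len a (rcons p (head z (labels B))) else -1) + balance x B z
  else 0.

Fixpoint linked (a : V) (st : seq pos) (z : V) : Prop :=
  if st is (x, o) :: B then
    (if o is Some p then chain (triangle X x) a (rcons p (head z (labels B))) else True)
    /\ linked x B z
  else True.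

Lemma head_cat (T : Type) (z : T) s t : head z (s ++ t) = head (head z t) s.
Proof. by case: s. Qed.

Lemma balance_cat a A B z :
  balance a (A ++ B) z = balance a A (head z (labels B)) + balance (last a (labels A)) B z.
Proof.
elim: A a => [|[x o] A IH] a /=; first by rewrite add0r.
by rewrite IH addrA labels_cat head_cat.
Qed.

Lemma linked_cat a A B z :
  linked a (A ++ B) z <-> linked a A (head z (labels B)) /\ linked (last a (labels A)) B z.
Proof.
elim: A a => [|[x o] A IH] a /=; first by tauto.
by rewrite IH labels_cat head_cat; tauto.
Qed.

(** Gives back swept stars: in a state, some of the positions born with label c are replaced by
the part of their links that has been swept.  The last argument counts the triangles given
back.  All these positions have the same label, hence no common triangle, and two of them can
be merged by a fold; this is why several positions have to be treated at once. *)
Inductive pushback (c : V) : seq pos -> seq V -> nat -> Prop :=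
| pushback_nil : pushback c [::] [::] 0
| pushback_keep x o st t k : pushback c st t k -> pushback c ((x, o) :: st) (x :: t) k
| pushback_star p st t k : pushback c st t k ->
    pushback c ((c, Some p) :: st) (p ++ t) ((size p).+1 + k)%N.

Lemma pushback_cat c A B t1 t2 k1 k2 :
  pushback c A t1 k1 -> pushback c B t2 k2 -> pushback c (A ++ B) (t1 ++ t2) (k1 + k2)%N.
Proof.
move=> H H2; elim: H => {A t1 k1} [|x o A t k _ IH|p A t k _ IH] //=.
- exact: pushback_keep.
- by rewrite -catA -addnA; exact: pushback_star.
Qed.

Lemma pushback_catP c A B t k : pushback c (A ++ B) t k ->
  exists t1 t2 k1 k2, [/\ pushback c A t1 k1, pushback c B t2 k2, t = t1 ++ t2 & k = (k1 + k2)%N].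
Proof.
elim: A t k => [|[x o] A IH] t k /=.
  by exists [::], t, 0%N, k; split=> //; exact: pushback_nil.
move E: ((x, o) :: A ++ B) => st H.
case: H E => {st t k} [|y o' st t k H|p st t k H] // [].
- move=> <- _ E; subst st; have [t1 [t2 [k1 [k2 [H1 H2 -> ->]]]]] := IH _ _ H.
  by exists (x :: t1), t2, k1, k2; split=> //; exact: pushback_keep.
- move=> -> -> E; subst st; have [t1 [t2 [k1 [k2 [H1 H2 -> ->]]]]] := IH _ _ H.
  exists (p ++ t1), t2, ((size p).+1 + k1)%N, k2; split=> //; rewrite ?catA ?addnA //.
  exact: pushback_star.
Qed.

Lemma pushback_consP c x o B t k : pushback c ((x, o) :: B) t k ->
  (exists2 t', t = x :: t' & pushback c B t' k) \/
  (exists p t' k', [/\ x = c, o = Some p, t = p ++ t', k = ((size p).+1 + k')%N &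
     pushback c B t' k']).
Proof.
move E: ((x, o) :: B) => st H; case: H E => {st t k} [|y o' st t k H|p st t k H] // [].
- by move=> -> _ ->; left; exists t.
- by move=> -> -> ->; right; exists p, t, k.
Qed.

Lemma pushback_labels c st : pushback c st (labels st) 0.
Proof. by elim: st => [|[x o] st IH]; [exact: pushback_nil|exact: pushback_keep]. Qed.

Lemma pushback_boundary c s t k :
  pushback c [seq (x, None) | x <- s] t k -> t = s /\ k = 0%N.
Proof.
elim: s t k => [|x s IH] t k /=.
  by move E: [::] => st H; case: H E.
by case/pushback_consP=> [[t' -> /IH[-> ->]] //|[p [t' [k' []]]]].
Qed.

Variables (s0 : seq V) (n0 : nat).

(** If i triangles have been crossed, then giving back k of them leaves a walk from which the
initial walk s0 is i - k triangles away. *)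
Definition tracked st i := forall c t k m, pushback c st t k -> filling X t m ->
  exists2 j, filling X s0 j & (j + k <= i + m)%N.

(** When an edge next to a position is pushed, its swept link grows by one edge. *)
Definition stretch_r (o : option (seq V)) x := if o is Some p then Some (rcons p x) else None.
Definition stretch_l x (o : option (seq V)) := if o is Some p then Some (x :: p) else None.
(** A fold c, b, c joins the link paths of the two positions through b.  A position of the
initial walk stays one. *)
Definition weld (o1 : option (seq V)) b (o2 : option (seq V)) :=
  if o1 is Some p1 then if o2 is Some p2 then Some (p1 ++ b :: p2) else None else None.

Section Push.
Variables (A B : seq pos) (a b x : V) (oa ob : option (seq V)).
Local Notation st := (A ++ (a, oa) :: (b, ob) :: B).
Local Notation st' := (A ++ (a, stretch_r oa b) :: (x, Some [::]) :: (b, stretch_l a ob) :: B).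
Hypothesis t : triangle X a b x.

(** The angles of the crossed triangle at a and b count only at positions born in the
sweep. *)
Lemma balance_push u z : balance u st' z = balance u st z + (1 - edge_len a b)
  - (if oa is Some _ then edge_len b x else 0) - (if ob is Some _ then edge_len x a else 0).
Proof.
rewrite !balance_cat /=; case: oa => [p|] /=; case: ob => [q|] /=;
  rewrite ?path_len_rcons ?last_rcons /= ?path_len_rcons ?[edge_len a x]edge_lenC; lra.
Qed.

(** The angles of a triangle add up to at most 1. *)
Lemma balance_push_le u z : balance u st z <= balance u st' z.
Proof.
rewrite balance_push; have := triangle_le1 t; have t2 := triangle_rot t.
have := triangle_ge0 t2; have := triangle_ge0 (triangle_rot t2).
by case: oa => [?|]; case: ob => [?|]; lra.
Qed.

Lemma linked_push u z : linked u st z -> linked u st' z.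
Proof.
have t1 := triangle_rot t; have t2 := triangle_rot t1.
have f1 := triangle_flip t; have f2 := triangle_flip t1.
rewrite !linked_cat /= => -[H [Ha [Hb HB]]]; split=> //; split; last split; last split=> //.
- by case: oa Ha => [p|] //=; rewrite !chain_rcons last_rcons.
- by split=> //.
- by case: ob Hb => [q|] //=.
Qed.

(** Giving back the star of a neighbour of the pushed edge leaves a spur, which is free. *)
Lemma tracked_push i : tracked st i -> tracked st' i.+1.
Proof.
case: (t) => ab bx xa _ T c t' k m.
case/pushback_catP=> [tA [t2 [kA [k2 [HA + -> ->]]]]].
case/pushback_consP=> [[t3 -> /pushback_consP]|].
  case=> [[t4 -> /pushback_consP]|].
    case=> [[t5 -> H5]|].
      move/(filling_push t)/(T c _ (kA + k2)%N) => [|j Hj le]; last by exists j => //; lia.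
      by apply: pushback_cat HA _; do 2 apply: pushback_keep.
    move=> [p [t5 [k5 [Ec Ep -> -> H5]]]].
    case: ob Ep T => [q|] //= [<-] T H.
    have := T c (tA ++ a :: q ++ t5) (kA + ((size q).+1 + k5))%N m.
    case.
    + by apply: pushback_cat HA _; apply: pushback_keep; rewrite Ec; exact: pushback_star.
    + by rewrite (filling_fold _ _ _ x) -/(cat _ _).
    + by move=> j Hj le; exists j => //=; lia.
  move=> [p [t4 [k4 [Ec [<-] -> -> /pushback_consP]]]] /=.
  case=> [[t5 -> H5]|[p' [t5 [k5 [Ec' _]]]]]; last by move: bx; rewrite Ec Ec' eqxx.
  move=> /(T c _ (kA + k4)%N)[|j Hj le]; last by exists j => //; lia.
  by apply: pushback_cat HA _; do 2 apply: pushback_keep.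
move=> [p [t3 [k3 [Ec Ep -> -> /pushback_consP]]]].
case=> [[t4 -> /pushback_consP]|[? [? [? [E _]]]]]; last by move: xa; rewrite Ec E eqxx.
case=> [[t5 -> H5]|[? [? [? [E _]]]]]; last by move: ab; rewrite Ec E eqxx.
case: oa Ep T => [q|] //= [<-] T H.
have := T c (tA ++ q ++ b :: t5) (kA + ((size q).+1 + k3))%N m.
case.
- by apply: pushback_cat HA _; rewrite Ec; apply: pushback_star; exact: pushback_keep.
- by rewrite catA (filling_fold _ _ _ x) -catA -cat_rcons.
- by move=> j Hj le; exists j => //; rewrite size_rcons; lia.
Qed.
End Push.

Section Fold.
Variables (A B : seq pos) (c b : V) (o1 o o2 : option (seq V)).
Local Notation st := (A ++ (c, o1) :: (b, o) :: (c, o2) :: B).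
Local Notation st' := (A ++ (c, weld o1 b o2) :: B).

(** The fold makes b interior.  If b was born in the sweep, its total angle is at least 2 by
assumption; this compensates the loss of one of the two positions of c. *)
Lemma balance_fold_le u z : linked u st z ->
  (forall p, o = Some p -> 2 <= path_len c (rcons p c)) -> balance u st z <= balance u st' z.
Proof.
rewrite linked_cat !balance_cat /= => -[_ [H1 [_ [H2 _]]]] Ho.
have {Ho} [q -> Hq] : exists2 q, (if o is Some p then 1 - path_len c (rcons p c) else -1) = q
    & q <= -1.
  by eexists; [reflexivity|case: o Ho => [p|//] /(_ p erefl); lra].
case: o1 H1 => [p1|] /= H1; case: o2 H2 => [p2|] /= H2.
- by rewrite rcons_cat path_len_cat !path_len_rcons /=; lra.
- by have := chain_path_len_ge0 H1; lra.
- by have := chain_path_len_ge0 H2; lra.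
- by lra.
Qed.

Lemma linked_fold u z : linked u st z -> linked u st' z.
Proof.
rewrite !linked_cat /= => -[H [H1 [_ [H2 HB]]]]; split=> //; split=> //.
case: o1 H1 => [p1|] //=; case: o2 H2 => [p2|] //=.
by rewrite rcons_cat !chain_rcons chain_cat /= chain_rcons; tauto.
Qed.

(** Giving back the star of the merged position means giving back both stars. *)
Lemma tracked_fold i : tracked st i -> tracked st' i.
Proof.
move=> T d t k m /pushback_catP[tA [t2 [kA [k2 [HA + -> ->]]]]].
case/pushback_consP=> [[t3 -> H3]|[p [t3 [k3 [Ed + -> -> H3]]]]].
- move/(filling_fold _ _ _ b); apply: T.
  by apply: pushback_cat HA _; do 3 apply: pushback_keep.
- case: o1 T => [p1|] //; case: o2 => [p2|] //= T [<-]; rewrite Ed in T *.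
  rewrite -catA /= => Hm.
  have [j Hj le] := T d _ _ m (pushback_cat HA (pushback_star p1
      (pushback_keep b o (pushback_star p2 H3)))) Hm.
  by exists j => //; move: le; rewrite size_cat /=; lia.
Qed.
End Fold.

(** The two ends of the walk always belong to the initial walk. *)
Definition anchored (st : seq pos) :=
  ~~ isSome (head None (map snd st)) && ~~ isSome (last None (map snd st)).

Lemma anchored_push A B a b x oa ob :
  anchored (A ++ (a, oa) :: (b, ob) :: B) ->
  anchored (A ++ (a, stretch_r oa b) :: (x, Some [::]) :: (b, stretch_l a ob) :: B).
Proof.
rewrite /anchored !map_cat !head_cat !last_cat /= => /andP[H1 H2]; apply/andP; split.
  by case: A H1 {H2} => [|y A] //=; case: oa.
by case: B H2 {H1} => [|y B] //=; case: ob.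
Qed.

Lemma anchored_fold A B c b o1 o o2 :
  anchored (A ++ (c, o1) :: (b, o) :: (c, o2) :: B) ->
  anchored (A ++ (c, weld o1 b o2) :: B).
Proof.
rewrite /anchored !map_cat !head_cat !last_cat /= => /andP[H1 H2]; apply/andP; split.
  by case: A H1 {H2} => [|y A] //=; case: o1.
by case: B H2 {H1} => [|y B] //=; case: o2 => //; case: o1.
Qed.

Lemma labels_split A u B st : labels st = A ++ u :: B ->
  exists A' o B', [/\ st = A' ++ (u, o) :: B', labels A' = A & labels B' = B].
Proof.
elim: st A => [|[x o] st IH] [|y A] //= [].
  by move=> -> <-; exists [::], o, st.
by move=> -> /IH[A1 [q [B1 [-> <- <-]]]]; exists ((y, o) :: A1), q, B1.
Qed.

Hypothesis minimal : forall n, filling X s0 n -> (n0 <= n)%N.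
Hypothesis short_link_filling : forall x c (p : seq V), X [fset x]%fset ->
  chain (triangle X x) c (rcons p c) ->
  path_len c (rcons p c) < 2 -> filling X (c :: rcons p c) (size p).

(** The balance does not decrease as long as every vertex folded away has total angle at least
2, and just before the last fold it is at most -3: there are then three positions, the two ends
and one between them.  A vertex born in the sweep with total angle less than 2 would allow a
filling of s0 with fewer than n0 triangles: give back its star and fill the closed path in its
link instead. *)
Lemma sweep_balance s n st i u z : sweep X s n -> (2 <= size s)%N -> labels st = s ->
  anchored st -> linked u st z -> tracked st i -> (i + n <= n0)%N -> balance u st z <= -3.
Proof.
move=> H; elim: H st i => {s n} [v n|A c b B n H IH|A a x b B n t H IH] // st i le E an ln tr len.
- have [A' [q1 [B' [Est EA EB0]]]] := labels_split E.
  have [B1 [q [B2 [EB EB1 EB2]]]] := labels_split (A := [::]) EB0.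
  case: B1 EB EB1 => // EB _; rewrite /= in EB; subst B'.
  have [B1 [q2 [B' [EB EB1 EB']]]] := labels_split (A := [::]) EB2.
  case: B1 EB EB1 => // EB _; rewrite /= in EB; subst B2 st.
  have Ho : forall p, q = Some p -> 2 <= path_len c (rcons p c).
    move=> p Eo; rewrite leNgt; apply/negP => lt2; rewrite Eo in ln tr.
    have ch : chain (triangle X b) c (rcons p c).
      by move: ln; rewrite linked_cat /=; tauto.
    have Xb : X [fset b]%fset.
      have [y [w /triangle_edge tb]] : exists y w, triangle X b y w.
        by case: (p) ch => [|y p'] /= [t1 _]; [exists c, c|exists c, y].
      by apply: simplex_sub tb _; rewrite !inE eqxx.
    (* The star of b has size p + 1 triangles, the filling of its link only size p. *)
    have F := short_link_filling Xb ch lt2.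
    have Hn := sweep_filling H; rewrite -EA -EB' in Hn.
    have [j Hj lej] := tr b (labels A' ++ c :: p ++ c :: labels B') _ _
      (pushback_cat (pushback_labels b A') (pushback_keep c q1
         (pushback_star p (pushback_labels b ((c, q2) :: B')))))
      (filling_insert F Hn).
    by have := minimal Hj; move: lej (len); rewrite ?addn0 ?add0n; lia.
  have le1 := balance_fold_le ln Ho.
  have [AB|AB] := boolP ((A' == [::]) && (B' == [::])).
    case/andP: AB => /eqP EA' /eqP EB''; subst A' B'.
    move: an; rewrite /anchored /=; case: (q1) => //; case: (q2) => //= _.
    by case: (q) Ho => [p|] //= => [/(_ p erefl)|_]; lra.
  apply: le_trans le1 _; apply: (IH _ i) => //.
  + rewrite -EA -EB' size_cat /= /labels !size_map.
    by case: (A') (B') AB => [|? ?] [|? ?] //= _; rewrite addnS.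
  + by rewrite labels_cat /= EA EB'.
  + exact: anchored_fold an.
  + exact: linked_fold ln.
  + exact: tracked_fold tr.
- have [A' [qa [B' [Est EA EB0]]]] := labels_split E.
  have [B1 [qb [B2 [EB EB1 EB2]]]] := labels_split (A := [::]) EB0.
  case: B1 EB EB1 => // EB _; rewrite /= in EB; subst B' st.
  apply: le_trans (balance_push_le _ _ _ _ t _ _) _; apply: (IH _ i.+1) => //.
  + by move: le; rewrite !size_cat /=; lia.
  + by rewrite labels_cat /= EA EB2.
  + exact: anchored_push.
  + exact: linked_push.
  + exact: tracked_push.
  + by rewrite addSnnS.
Qed.

Hypothesis no_backtrack : forall a b, (a, b) \in darts s0 -> (b, a) \notin darts s0.
Hypothesis no_corner : forall a b c, (a, b) \in darts s0 -> (b, c) \in darts s0 ->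
  ~ triangle X a b c.

(** All edges of s0 are pushed first.  This is possible, because the inverse of an edge of s0
never appears: it would be a side of a triangle containing two successive edges of s0.  Each of
these pushes adds 1 - l(e) to the balance. *)
Lemma collar_sweep R0 Y v i u z : let st := Y ++ (v, None) :: [seq (x, None) | x <- R0] in
  sorted (fun a b => a != b) (labels st) ->
  {subset darts (v :: R0) <= darts s0} ->
  (forall a b, (a, b) \in darts s0 -> (b, a) \notin darts (labels st)) ->
  anchored st -> linked u st z -> tracked st i -> (i <= n0)%N ->
  filling X (labels st) (n0 - i) ->
  exists st' i', [/\ anchored st', linked u st' z, tracked st' i', (i' <= n0)%N &
   [/\ filling X (labels st') (n0 - i'), sorted (fun a b => a != b) (labels st'),
     (size st <= size st')%N &
     balance u st' z = balance u st z + (size R0)%:R - path_len v R0]].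
Proof.
elim: R0 Y v i => [|w R0 IH] Y v i /= srt sub nb an ln tr le F.
  by exists (Y ++ [:: (v, None)]), i; split=> //; split=> //; rewrite addr0 subr0.
have lb : labels (Y ++ [:: (v, None), (w, None) & [seq (x, None) | x <- R0]])
    = labels Y ++ v :: w :: R0.
  by rewrite labels_cat /= /labels -map_comp map_id_in.
rewrite lb in srt nb F.
have vw : v != w.
  by move: srt; rewrite -cat_rcons; case: (labels Y) => [|y L] /=; rewrite ?cat_path /= ?last_rcons => /andP[] // _ /andP[].
have vw_s0 : (v, w) \in darts s0 by apply: sub; rewrite /= (negPf vw) inE eqxx.
have ED : darts (labels Y ++ v :: w :: R0) = darts (rcons (labels Y) v) ++ (v, w) :: darts (w :: R0).
  by rewrite darts_cat /= (negPf vw).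
have Fe : fill (@swap V) (across X) (darts (rcons (labels Y) v) ++ (v, w) :: darts (w :: R0)) (n0 - i).
  by rewrite -ED.
have nbe : swap (v, w) \notin darts (rcons (labels Y) v) ++ (v, w) :: darts (w :: R0).
  by rewrite -ED; exact: nb.
have [[g1 x] [[h1 h2] [k [/= [/= E1 E2 E3 t] Ek Hk]]]] :=
  fill_peel (@swapK V) (@acrossL V X) (@acrossR V X) Fe nbe.
case: (t) => _ wx xv _.
subst g1 h1 h2.
have lbx : labels ((Y ++ [:: (v, None); (x, Some [::])]) ++ (w, None) :: [seq (x, None) | x <- R0])
    = labels Y ++ v :: x :: w :: R0.
  by rewrite -catA labels_cat /= /labels -map_comp map_id_in.
have dx : darts (labels Y ++ v :: x :: w :: R0) =
    darts (rcons (labels Y) v) ++ (v, x) :: (x, w) :: darts (w :: R0).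
  by rewrite darts_cat /= (eq_sym v) (negPf xv) (eq_sym x) (negPf wx).
have [||||||||st' [i' [an' ln' tr' le' [F' srt' sz' pe']]]] :=
    IH (Y ++ [:: (v, None); (x, Some [::])]) w i.+1.
- by rewrite lbx; exact: (sorted_neq_push t srt).
- by move=> f fR; apply: sub; rewrite /= (negPf vw) inE fR orbT.
- move=> a b ab; rewrite lbx dx mem_cat !inE !negb_or.
  have := nb _ _ ab; rewrite ED mem_cat inE !negb_or => /and3P[-> _ ->].
  rewrite andbT /=; apply/andP; split; apply/negP => /eqP[Eb Ea]; subst a b.
  + exact: (no_corner ab vw_s0 (triangle_rot (triangle_rot t))).
  + exact: (no_corner vw_s0 ab t).
- by rewrite -catA; exact: (anchored_push x an).
- by rewrite -catA; exact: (linked_push t ln).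
- by rewrite -catA; exact: (tracked_push t tr).
- by lia.
- rewrite lbx /filling dx; have -> : (n0 - i.+1)%N = k by lia.
  exact: Hk.
exists st', i'; split=> //; split=> //.
  by apply: leq_trans sz'; rewrite !size_cat /= !size_map; lia.
rewrite pe' -catA (@balance_push Y _ v w x None None) /= -addn1 natrD; lra.
Qed.

Hypothesis s0_size : (2 <= size s0)%N.
Hypothesis s0_sorted : sorted (fun a b => a != b) s0.
Hypothesis s0_filling : filling X s0 n0.

(** Gauss-Bonnet: with m edges, the balance is -(m + 1) at the start, -1 - l(s0) after the
first pushes along all edges, and at most -3 until the walk is a point. *)
Lemma closed_walk_length v R0 : s0 = v :: R0 -> 2 <= path_len v R0.
Proof.
move=> E.
have lb : labels [seq (x, None) | x <- s0] = s0 by rewrite /labels -map_comp map_id_in.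
have pb z u s : balance u [seq (x, None) | x <- s] z = - (size s)%:R.
  elim: s u => [|x s IH] u /=; first by rewrite oppr0.
  by rewrite IH -addn1 natrD; lra.
have lnb z u s : linked u [seq (x, None) | x <- s] z.
  by elim: s u => [|x s IH] u //=.
have Est : [::] ++ (v, None) :: [seq (x, None) | x <- R0] = [seq (x, None : option (seq V)) | x <- s0].
  by rewrite E.
have := @collar_sweep R0 [::] v 0 v v; cbv zeta; rewrite Est lb.
case=> //.
- by move=> f; rewrite -E.
- by rewrite /anchored E /=; case: (R0) s0_size => // y s _; elim: s y.
- by move=> c t k m /pushback_boundary[-> ->] F; exists m => //; lia.
- by rewrite subn0.
move=> st' [i' [an ln tr le [F srt sz pe]]].
have Hs : sweep X (labels st') (n0 - i').
  by apply: filling_sweep => //; case: (st') sz => //; rewrite size_map leqNgt; case: (s0) s0_size.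
have : balance v st' v <= -3.
  apply: (sweep_balance Hs _ erefl an ln tr); last by rewrite subnKC.
  by rewrite /labels size_map; apply: leq_trans sz; rewrite size_map.
rewrite pe pb E /= -addn1 natrD; lra.
Qed.
End GaussBonnet.

(** * Short closed walks in a large complex *)

Section Polygon.
Variables (R : realType) (V : choiceType) (L : length_complex R V).

Definition walk_len (s : seq V) : R := \sum_(f <- darts s) edge_len L f.1 f.2.

Lemma walk_len_cat A c B : walk_len (A ++ c :: B) = walk_len (rcons A c) + walk_len (c :: B).
Proof. by rewrite /walk_len darts_cat big_cat. Qed.

Lemma walk_len_path a s : sorted (fun a b => a != b) (a :: s) -> walk_len (a :: s) = path_len L a s.
Proof.
elim: s a => [|b s IH] a /=; first by rewrite /walk_len big_nil.
by case/andP=> /negPf ab /IH <-; rewrite /walk_len /= ab big_cons.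
Qed.

(** Only consecutive distinct vertices are asked to be adjacent in K, through the letters of the walk. *)
Definition edge_walk (K : complex V) (s : seq V) := sorted (fun a b => a != b) s /\
  forall a b, (a, b) \in darts s -> K [fset a; b]%fset.

Lemma edge_walk_cat K A c B :
  edge_walk K (A ++ c :: B) <-> edge_walk K (rcons A c) /\ edge_walk K (c :: B).
Proof.
have E : sorted (fun a b => a != b) (A ++ c :: B) =
    sorted (fun a b => a != b) (rcons A c) && sorted (fun a b => a != b) (c :: B).
  by case: A => [|a A] //=; rewrite cat_path rcons_path /= andbA.
rewrite /edge_walk E darts_cat; split=> [[/andP[-> ->] H]|[[-> H1] [-> H2]]].
  by do 2 split=> //; move=> a b ab; apply: H; rewrite mem_cat ab ?orbT.
by split=> // a b; rewrite mem_cat => /orP[/H1|/H2].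
Qed.

Hypothesis fl : flag L.
Hypothesis full_cycle_len : forall c p, (3 <= size p)%N -> edge_walk L (c :: rcons p c) ->
  (forall A u P v B, c :: p = A ++ u :: P ++ v :: B -> P != [::] ->
     (A != [::]) || (B != [::]) -> u <> v /\ ~ L [fset u; v]%fset) ->
  2 <= walk_len (c :: rcons p c).

Lemma edge_walk2 a b : a != b -> L [fset a; b]%fset -> edge_walk L [:: a; b].
Proof.
move=> ab Lab; split; first by rewrite /= ab.
by move=> c d; rewrite /= (negPf ab) inE => /eqP[-> ->].
Qed.

Lemma edge_walk_triangle c y z : edge_walk L [:: c; y; z; c] -> triangle L c y z.
Proof.
move=> [/and4P[cy yz zc _] H].
have Lcy : L [fset c; y]%fset by apply: H; rewrite /= (negPf cy) inE eqxx.
have Lyz : L [fset y; z]%fset by apply: H; rewrite /= (negPf cy) (negPf yz) !inE eqxx orbT.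
have Lzc : L [fset z; c]%fset.
  by apply: H; rewrite /= (negPf cy) (negPf yz) (negPf zc) !inE eqxx !orbT.
split=> //; apply: fl.
- by apply/fset0Pn; exists c; rewrite !inE eqxx.
- move=> v; rewrite !inE -orbA => /or3P[]/eqP->.
  + by apply: simplex_sub Lcy _; rewrite !inE eqxx.
  + by apply: simplex_sub Lcy _; rewrite !inE eqxx orbT.
  + by apply: simplex_sub Lyz _; rewrite !inE eqxx orbT.
- move=> u v; rewrite !inE -!orbA => /or3P[]/eqP-> /or3P[]/eqP-> uv; try by rewrite eqxx in uv.
  all: apply: edge_pair => //; by rewrite // fsetUC.
Qed.

Lemma triangle_ineq a b c : triangle L a b c -> edge_len L a b <= edge_len L b c + edge_len L c a.
Proof. by case=> ab bc ca H; have [_] := (lenP L).2 a b c ab bc ca H. Qed.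

Lemma edge_walk_ge0 s : edge_walk L s -> 0 <= walk_len s.
Proof.
move=> [srt H]; rewrite /walk_len big_seq; apply: sumr_ge0 => -[a b] ab /=.
have ne : a != b.
  elim: s srt ab {H} => [|x [|y s] IH] //= /andP[xy p].
  by rewrite (negPf xy) inE => /orP[/eqP[-> ->]|/(IH p)].
by have /andP[] := edge_len_bounds ne (H _ _ ab).
Qed.

(** Induction on the number of edges.  A closed walk with at least four edges and length
less than 2 is not a full cycle, so it repeats a vertex or has a chord, and it splits into two
shorter walks.  In the second case the shorter part has length less than 1 and stays below 2
with the chord; the inequality proved along with the filling then bounds the chord by this
part, and so the other part also stays below 2 when it is closed by the chord.  The area k - 2
is that of a polygon with k sides triangulated without interior vertices. *)
Lemma polygon_filling s c q : s = c :: q -> (2 <= size q)%N -> last c q = c ->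
  edge_walk L s -> walk_len s < 2 ->
  filling L s (size q - 2) /\
  forall a b, (a, b) \in darts s -> edge_len L a b *+ 2 <= walk_len s.
Proof.
have [n] := ubnP (size q); elim: n s c q => // n IH s c q; rewrite ltnS => szn Es sz2 lst ew lt2.
case/lastP: q => [|p c'] // in szn Es sz2 lst *; rewrite last_rcons in lst; subst c' s.
rewrite size_rcons ltnS in sz2; rewrite size_rcons in szn *.
case: p sz2 szn ew lt2 => [|y [|z [|w p]]] // _ szn ew lt2.
- case: (ew) => /and3P[cy yc _] _; split.
    by apply/(filling_fold _ [::] c y [::]); exact: fill_nil.
  move=> a b; rewrite /walk_len /= (negPf cy) (negPf yc) !big_cons big_nil /= addr0 (edge_lenC L y c).
  by rewrite !inE => /orP[]/eqP[-> ->]; rewrite mulr2n // edge_lenC.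
- have t := edge_walk_triangle ew; case: (t) => cy yz zc _; split.
    apply: (filling_push (A := [:: c]) (B := [:: c]) (triangle_rot t)).
    apply/(filling_fold _ [:: c; y] c z [::]).
    by apply/(filling_fold _ [::] c y [::]); exact: fill_nil.
  have t1 := triangle_ineq t; have t2 := triangle_ineq (triangle_rot t).
  have t3 := triangle_ineq (triangle_rot (triangle_rot t)).
  move=> a b; rewrite /walk_len /= (negPf cy) (negPf yz) (negPf zc) /= !big_cons big_nil /=.
  by rewrite !inE => /or3P[]/eqP[-> ->]; rewrite mulr2n; lra.
set p' := [:: y, z, w & p] in szn ew lt2 *.
have [A [u [P [v [B [E P0 AB uv]]]]]] : exists A u P v B, [/\ c :: p' = A ++ u :: P ++ v :: B,
    P != [::], (A != [::]) || (B != [::]) & u = v \/ (u != v /\ L [fset u; v]%fset)].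
  apply: contrapT => no; move: lt2; rewrite ltNge => /negP; apply.
  apply: full_cycle_len => // A u P v B E P0 AB; split=> [uv|uv]; apply: no;
    exists A, u, P, v, B; split=> //; first by left.
  by have [->|] := eqVneq u v; [left|right].
rewrite -rcons_cons E rcons_cat /= rcons_cat /= in szn ew lt2 *.
have szp : (size p).+3 = (size A + size P + size B).+1.
  by have := congr1 size E; rewrite /= !size_cat /= size_cat /=; lia.
have P1 : (0 < size P)%N by case: (P) P0.
have hd : head c (A ++ [:: u]) = c by case: (A) E => [|a A'] [].
have [ewA] := (edge_walk_cat _ _ _ _).1 ew; rewrite -cat_cons => /edge_walk_cat[ewP ewB].
have lenE : walk_len (A ++ u :: P ++ v :: rcons B c) =
    walk_len (rcons A u) + walk_len (u :: rcons P v) + walk_len (v :: rcons B c).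
  by rewrite walk_len_cat -cat_cons walk_len_cat addrA.
have dE : darts (A ++ u :: P ++ v :: rcons B c) =
    darts (rcons A u) ++ darts (u :: rcons P v) ++ darts (v :: rcons B c).
  by rewrite darts_cat -cat_cons darts_cat.
rewrite lenE dE in lt2 *.
have lA := edge_walk_ge0 ewA; have lP := edge_walk_ge0 ewP; have lB := edge_walk_ge0 ewB.
have behead_split (T : seq V) : A ++ u :: T = c :: behead (A ++ u :: T).
  by case: (A) hd => [|a A'] /= ->.
have behead_size (T : seq V) : size (behead (A ++ u :: T)) = (size A + size T)%N.
  by rewrite size_behead size_cat /=; lia.
have behead_last (T : seq V) : last u T = c -> last c (behead (A ++ u :: T)) = c.
  by move=> l; rewrite -[LHS]/(last c (c :: behead (A ++ u :: T))) -behead_split last_cat.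
have AB1 : (1 <= size A + size B)%N by case: (A) (B) AB => [|? ?] [|? ?].
have n1 : ((size P).+2 < n)%N by lia.
have n2 : (size A + (size B).+2 < n)%N by lia.
case: uv => [uv|[uv Luv]].
- subst v.
  have [||||F1 e1] := IH _ u (rcons P u) _ erefl _ _ ewP; rewrite ?size_rcons ?last_rcons //; [lia|lra|].
  have l2 : walk_len (A ++ u :: rcons B c) = walk_len (rcons A u) + walk_len (u :: rcons B c).
    exact: walk_len_cat.
  have [||||||F2 e2] := IH (A ++ u :: rcons B c) c (behead (A ++ u :: rcons B c)).
  + by rewrite behead_size size_rcons; lia.
  + exact: behead_split.
  + by rewrite behead_size size_rcons; lia.
  + by apply: behead_last; rewrite last_rcons.
  + exact/edge_walk_cat.
  + by rewrite l2; lra.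
  split.
    have := filling_insert F1 F2; apply: filling_weak.
    by rewrite behead_size !size_rcons; lia.
  move=> a b; rewrite !mem_cat => /or3P[H|/e1|H]; last 1 first.
  + by have := e2 a b; rewrite darts_cat mem_cat H orbT l2 => /(_ erefl); lra.
  + by have := e2 a b; rewrite darts_cat mem_cat H l2 => /(_ erefl); lra.
  + by lra.
- have vu : v != u by rewrite eq_sym.
  have Lvu : L [fset v; u]%fset by rewrite fsetUC.
  have /andP[el0 el2] := edge_len_bounds uv Luv.
  have l1 : walk_len (u :: rcons (rcons P v) u) = walk_len (u :: rcons P v) + edge_len L u v.
    rewrite -cats1 cat_rcons -cat_cons walk_len_cat; congr (_ + _).
    by rewrite /walk_len /= (negPf vu) big_cons big_nil addr0 edge_lenC.
  have d1 : darts (u :: rcons (rcons P v) u) = darts (u :: rcons P v) ++ [:: (v, u)].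
    by rewrite -cats1 cat_rcons -cat_cons darts_cat /= (negPf vu).
  have ew1 : edge_walk L (u :: rcons (rcons P v) u).
    rewrite -cats1 cat_rcons -cat_cons; apply/edge_walk_cat; split=> //.
    exact: edge_walk2.
  have l2 : walk_len (A ++ u :: v :: rcons B c) = walk_len (rcons A u) + edge_len L u v + walk_len (v :: rcons B c).
    rewrite walk_len_cat -addrA; congr (_ + _).
    by rewrite (walk_len_cat [:: u]) /walk_len /= (negPf uv) big_cons big_nil addr0.
  have d2 : darts (A ++ u :: v :: rcons B c) = darts (rcons A u) ++ (u, v) :: darts (v :: rcons B c).
    by rewrite darts_cat /= (negPf uv).
  have ew2 : edge_walk L (A ++ u :: v :: rcons B c).
    apply/edge_walk_cat; split=> //; apply/(edge_walk_cat _ [:: u]); split=> //.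
    exact: edge_walk2.
  have I1 : walk_len (u :: rcons (rcons P v) u) < 2 ->
      filling L (u :: rcons (rcons P v) u) (size P) /\
      forall a b, (a, b) \in darts (u :: rcons (rcons P v) u) ->
      edge_len L a b *+ 2 <= walk_len (u :: rcons (rcons P v) u).
    move=> lt1; have [|||F1 e1] := IH _ u (rcons (rcons P v) u) _ erefl _ _ ew1 lt1;
      rewrite ?size_rcons ?last_rcons //.
    by split=> //; apply: filling_weak F1; rewrite !size_rcons subn2.
  have I2 : walk_len (A ++ u :: v :: rcons B c) < 2 ->
      filling L (A ++ u :: v :: rcons B c) (size A + size B) /\
      forall a b, (a, b) \in darts (A ++ u :: v :: rcons B c) ->
      edge_len L a b *+ 2 <= walk_len (A ++ u :: v :: rcons B c).
    move=> lt1; have [|||F2 e2] := IH (A ++ u :: v :: rcons B c) c _ _ (behead_split _) _ _ ew2 lt1.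
    + by rewrite behead_size /= size_rcons.
    + by rewrite behead_size /= size_rcons !addnS.
    + by apply: behead_last; rewrite /= last_rcons.
    by split=> //; apply: filling_weak F2; rewrite behead_size /= !size_rcons !addnS subn2.
  have m1 : (v, u) \in darts (u :: rcons (rcons P v) u) by rewrite d1 mem_cat inE eqxx orbT.
  have m2 : (u, v) \in darts (A ++ u :: v :: rcons B c) by rewrite d2 mem_cat inE eqxx orbT.
  (* The part of length less than 1 is treated first, whichever it is. *)
  have [lt1 lt2'] : walk_len (u :: rcons (rcons P v) u) < 2 /\
      walk_len (A ++ u :: v :: rcons B c) < 2.
    have [le|le] := leP (walk_len (u :: rcons P v)) (walk_len (rcons A u) + walk_len (v :: rcons B c)).
      have lt1 : walk_len (u :: rcons (rcons P v) u) < 2 by rewrite l1; lra.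
      by split=> //; have := (I1 lt1).2 _ _ m1; rewrite l1 l2 edge_lenC; lra.
    have lt1 : walk_len (A ++ u :: v :: rcons B c) < 2 by rewrite l2; lra.
    by split=> //; have := (I2 lt1).2 _ _ m2; rewrite l1 l2; lra.
  have [F1 e1] := I1 lt1; have [F2 e2] := I2 lt2'.
  have := e1 _ _ m1; have := e2 _ _ m2; rewrite (edge_lenC L v u) l1 l2 => i2 i1.
  split.
    have := filling_insert F1 F2; rewrite -cats1 -catA /= => F.
    have := (filling_fold L (A ++ u :: P) v u (rcons B c) _).2.
    rewrite -!catA /= => G; apply: G; apply: filling_weak F; clear -szp; lia.
  move=> a b; rewrite !mem_cat => /or3P[H|H|H].
  + by have := e2 a b; rewrite d2 mem_cat H l2 => /(_ erefl); lra.
  + by have := e1 a b; rewrite d1 mem_cat H l1 => /(_ erefl); lra.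
  + by have := e2 a b; rewrite d2 mem_cat inE H !orbT l2 => /(_ erefl); lra.
Qed.
End Polygon.

Local Open Scope classical_set_scope.

(** * Geometric realizations *)

Section Quotient.
Variables (K S T : topologicalType) (A : set K) (B : set S) (h : K -> S) (e : K -> T) (F : S -> T).

(** A continuous surjection from a compact space onto a subset of a Hausdorff space is a
quotient map. *)
Lemma quotient_continuous : compact A -> hausdorff_space S ->
  {within A, continuous h} -> {within A, continuous e} ->
  B = h @` A -> (forall t, A t -> F (h t) = e t) -> {within B, continuous F}.
Proof.
move=> cA hS ch ce EB EF; apply/continuous_closedP => C cC.
case/continuous_closedP/(_ _ cC)/closed_subspaceP: ce => W cW EW.
have cAW : compact (A `&` W) by exact: compact_closedI.
have sub : A `&` W `<=` A by move=> x [].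
apply/closed_subspaceP; exists (h @` (A `&` W)).
  apply: compact_closed => //; apply: continuous_compact cAW.
  exact: continuous_subspaceW sub ch.
rewrite EB; apply/seteqP; split=> x [].
- move=> [t [At Wt] <-] _; split; last by exists t.
  suff Ce : C (e t) by rewrite -(EF t At) in Ce.
  have : (W `&` A) t by [].
  by rewrite EW => -[].
- move=> /= Cx [t At Et]; split; last by exists t.
  have Ct : C (e t) by rewrite -(EF t At) Et.
  exists t => //; split=> //.
  have : ((e @^-1` C) `&` A) t by [].
  by rewrite -EW => -[].
Qed.
End Quotient.

Section Realization.
Variables (R : realType) (V : choiceType) (Y : complex V).
Notation geom := (realization R V Y).

Lemma bary_inj (x y : geom) : (forall v, x v = y v) -> x = y.
Proof.
case: x => f f0 fs; case: y => g g0 gs /= /funext E.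
by subst g; congr Realization; exact: Prop_irrelevance.
Qed.

Lemma realization_openE (U : set geom) : open U <-> weak_open U.
Proof.
rewrite openE; split=> [H s Ys x sx Ux|H x Ux].
  have [B [oB Bx sub]] := H x Ux.
  have [e e0 He] := oB s Ys x sx Bx.
  by exists e => // y sy yx; apply/sub/He.
by exists U; split.
Qed.

Lemma coord_open (v : V) (W : set R) : open W -> open [set y : geom | W (y v)].
Proof.
move=> oW; apply/realization_openE => s Ys x sx /= Wx.
have /nbhs_ballP[e /= e0 He] := open_nbhs_nbhs (conj oW Wx).
exists e => // y sy xy; apply: He; rewrite /ball /=.
have [vs|vs] := boolP (v \in s); first exact: xy.
by rewrite sx // sy // subrr normr0.
Qed.

Lemma coord_continuous (v : V) : continuous (fun y : geom => y v).
Proof. by apply/continuousP => W oW; exact: coord_open. Qed.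

Lemma realization_hausdorff : hausdorff_space geom.
Proof.
rewrite open_hausdorff => x y xy.
have [v vxy] : exists v, x v != y v.
  apply: contrapT => no; move/eqP: xy; apply; apply: bary_inj => v.
  by apply/eqP; apply: contrapT => /negP H; apply: no; exists v.
have : hausdorff_space R by exact: norm_hausdorff.
rewrite open_hausdorff => /(_ _ _ vxy)[[A B] /= [Ax By] [oA oB /eqP AB]].
exists ([set z : geom | A (z v)], [set z : geom | B (z v)]) => /=.
  by rewrite !inE /=; split; [move: Ax|move: By]; rewrite inE.
split; try exact: coord_open.
apply/eqP/seteqP; split=> // z [Az Bz].
by have : (A `&` B) (z v) by []; rewrite AB.
Qed.

(** The weak topology asks only for neighbourhoods inside each closed simplex. *)
Lemma simplex_continuous (T : pseudoMetricType R) (A : set T) (h : T -> geom) s C :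
  Y s -> 0 < C -> (forall t, A t -> supported s (h t)) ->
  (forall t t' e, A t -> A t' -> ball t e t' -> forall v, `|h t v - h t' v| <= C * e) ->
  {within A, continuous h}.
Proof.
move=> Ys C0 sup lip; apply/subspace_continuousP => t At W [U [oU Ut sub]].
have [e e0 He] := oU s Ys (h t) (sup t At) Ut.
have d0 : 0 < e / 2 / C by rewrite !divr_gt0.
apply/nbhs_ballP; exists (e / 2 / C) => // t' tt' At'; apply: sub; apply: He.
  exact: sup.
move=> v _; apply: le_lt_trans (lip _ _ _ At At' tt' v) _.
by rewrite mulrC divfK ?gt_eqF // ltr_pdivrMr // ltr_pMr // ltr1n.
Qed.

Section EdgePath.
Variables (a0 : V).

Definition delta (a v : V) : R := (a == v)%:R.

(** Barycentric coordinates, at time t, of the point that walks along the vertices a :: s at unit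
speed per edge. *)
Fixpoint path_coord (a : V) (s : seq V) (t : R) (v : V) : R :=
  if s is b :: s' then
    if t <= 1 then (1 - t) * delta a v + t * delta b v else path_coord b s' (t - 1) v
  else delta a v.

Lemma path_coord_segment a s i (t : R) v : (i < size s)%N -> i%:R <= t <= i.+1%:R ->
  path_coord a s t v = (1 - (t - i%:R)) * delta (nth a0 (a :: s) i) v
             + (t - i%:R) * delta (nth a0 (a :: s) i.+1) v.
Proof.
elim: s a i t => [|b s IH] a [|i] t //=.
  by rewrite subr0 => _ /andP[_ ->].
rewrite ltnS => si; rewrite -(natr1 i.+1) -(natr1 i) => /andP[t1 t2].
have E x : x - (i%:R + 1) = x - 1 - i%:R :> R by lra.
have [le|lt] := leP t 1; last first.
  by rewrite (IH _ i) // ?E // -natr1; apply/andP; split; lra.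
have i0 : i = 0%N.
  case: i t1 {si t2 E} => // i; rewrite -natr1 => ti; exfalso; have := ler0n R i; lra.
subst i; have -> : t = 1 by move: t1; rewrite add0r; lra.
by rewrite add0r !subrr !mul0r subr0 !mul1r add0r addr0.
Qed.

Definition delta_sum (a : V) s : a \in s -> uniq s -> \sum_(v <- s) delta a v = 1.
Proof.
move=> sa us; rewrite (bigD1_seq a) //= /delta eqxx big1 ?addr0 // => v /negPf.
by rewrite eq_sym => ->.
Qed.

Lemma segment_point (a b : V) (t : R) : Y [fset a; b]%fset -> 0 <= t <= 1 ->
  exists y : geom, (forall v, y v = (1 - t) * delta a v + t * delta b v)
     /\ supported [fset a; b]%fset y.
Proof.
move=> Yab /andP[t0 t1].
pose f v := (1 - t) * delta a v + t * delta b v.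
have f0 v : 0 <= f v by rewrite addr_ge0 // mulr_ge0 ?subr_ge0 // /delta ler0n.
have sf : supported [fset a; b]%fset f.
  move=> v; rewrite !inE negb_or => /andP[va vb].
  by rewrite /f /delta (eq_sym a) (eq_sym b) (negPf va) (negPf vb) !mulr0 addr0.
have fs : exists s, [/\ Y s, supported s f & \sum_(v <- s) f v = 1].
  exists [fset a; b]%fset; split=> //.
  rewrite /f big_split /= -!mulr_sumr !delta_sum ?fset_uniq ?inE ?eqxx ?orbT //.
  by rewrite !mulr1 subrK.
by exists (Realization f0 fs).
Qed.

Definition edge_path s := forall i, (i.+1 < size s)%N -> Y [fset nth a0 s i; nth a0 s i.+1]%fset.

Lemma nat_interval_cover (t : R) n : (0 < n)%N -> 0 <= t <= n%:R ->
  exists2 i, (i < n)%N & i%:R <= t <= i.+1%:R.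
Proof.
elim: n t => // n IH t _ /andP[t0 tn].
have [le|lt] := leP n%:R t; first by exists n => //; rewrite le.
case: n IH tn lt => [|n] IH tn lt; first by rewrite ltNge t0 in lt.
have [//||i ni it] := IH t; first by rewrite t0 ltW.
by exists i => //; rewrite ltnS ltnW.
Qed.

Lemma edge_path_param a s : (0 < size s)%N -> edge_path (a :: s) ->
  exists h : R -> geom, [/\ forall t v, 0 <= t <= (size s)%:R -> h t v = path_coord a s t v,
    {within `[0, (size s)%:R], continuous h} &
    forall i t, (i < size s)%N -> i%:R <= t <= i.+1%:R ->
      supported [fset nth a0 (a :: s) i; nth a0 (a :: s) i.+1]%fset (h t)].
Proof.
move=> s0 ep.
have [h Hh] : exists h : R -> geom, forall t : R, 0 <= t <= (size s)%:R ->
    forall v, h t v = path_coord a s t v.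
  have : forall t : R, exists y : geom, 0 <= t <= (size s)%:R -> forall v, y v = path_coord a s t v.
    move=> t.
    have [t01|t01] := boolP (0 <= t <= (size s)%:R); last first.
      have [|y _] := @segment_point _ _ 0 (ep 0%N s0); first by rewrite lexx ler01.
      by exists y.
    have [i si it] := nat_interval_cover s0 t01.
    have [|y [Ey _]] := @segment_point _ _ (t - i%:R) (ep i si).
      by move: it; rewrite -natr1 => /andP[? ?]; apply/andP; split; lra.
    by exists y => _ v; rewrite Ey (path_coord_segment _ _ si it).
  by move/choice => [h Hh]; exists h => t /Hh.
have bd i (t : R) : (i < size s)%N -> i%:R <= t <= i.+1%:R -> 0 <= t <= (size s)%:R.
  move=> si /andP[t1 t2]; apply/andP; split; first exact: le_trans t1.
  by apply: le_trans t2 _; rewrite ler_nat.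
have sp i (t : R) : (i < size s)%N -> i%:R <= t <= i.+1%:R ->
      supported [fset nth a0 (a :: s) i; nth a0 (a :: s) i.+1]%fset (h t).
  move=> si it v; rewrite !inE negb_or => /andP[va vb].
  rewrite Hh ?(bd i) // (path_coord_segment _ _ si it) /delta eq_sym (negPf va) eq_sym (negPf vb).
  by rewrite !mulr0 addr0.
exists h; split=> //; first by move=> t v /Hh.
suff : forall k, (k <= size s)%N -> {within `[0, k%:R], continuous h} by apply.
elim=> [_|k IH ks].
  by rewrite set_itv1; exact: continuous_subspace1.
have -> : `[0, k.+1%:R]%classic = `[0, k%:R] `|` `[k%:R, k.+1%:R] :> set R.
  apply/seteqP; split=> t /=; rewrite !in_itv /=.
    by case/andP=> t0 tk; have [?|/ltW ?] := leP t k%:R; [left|right]; apply/andP.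
  have : k%:R <= k.+1%:R :> R by rewrite ler_nat.
  have := ler0n R k.
  by move=> k0 kk [/andP[t0 tk]|/andP[t0 tk]]; apply/andP; split; lra.
apply: withinU_continuous; [exact: itv_closed|exact: itv_closed|apply: IH; exact: ltnW|].
apply: (@simplex_continuous _ _ _ [fset nth a0 (a :: s) k; nth a0 (a :: s) k.+1]%fset 1) => //.
- exact: ep.
- by move=> t /=; rewrite in_itv /=; exact: sp.
- move=> t t' e /=; rewrite !in_itv /= => tk tk' tt' v.
  rewrite !Hh ?(bd k) // !(path_coord_segment _ _ ks) //.
  move: tt'; rewrite /ball /= mul1r => /ltW tt'; apply: le_trans tt'.
  set x := delta _ _; set y := delta _ _.
  have -> : (1 - (t - k%:R)) * x + (t - k%:R) * y - ((1 - (t' - k%:R)) * x + (t' - k%:R) * y)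
     = (t - t') * (y - x) by lra.
  rewrite normrM ler_piMr // /x /y /delta; do 2 case: eqP => _ /=.
  all: by rewrite ?subrr ?subr0 ?sub0r ?normrN ?normr0 ?normr1.
Qed.
End EdgePath.
End Realization.

(** * The realization of a polygon is a circle *)

Section Angle.
Variable R : realType.

(** The cosine of the difference of the angles is 1, and the sine has no zero inside a half turn. *)
Lemma angle_inj (x y : R) : 0 <= x < pi *+ 2 -> 0 <= y < pi *+ 2 ->
  cos x = cos y -> sin x = sin y -> x = y.
Proof.
move=> /andP[x0 x2] /andP[y0 y2] cxy sxy.
pose z := (x - y) / 2.
have zE : x - y = z *+ 2 by rewrite /z -mulr_natr divfK.
have c1 : cos (z *+ 2) = 1 by rewrite -zE cosB cxy sxy -!expr2 cos2Dsin2.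
have sz : sin z = 0.
  have := cos2Dsin2 z; move: c1; rewrite cos_mulr2n => c1 cs.
  by apply/eqP; rewrite -sqrf_eq0; apply/eqP; lra.
have [z0|z0|z0] := ltgtP z 0.
- have : 0 < sin (- z) by apply: sin_gt0_pi; apply/andP; split; move: zE; lra.
  by rewrite sinN sz oppr0 ltxx.
- have : 0 < sin z by apply: sin_gt0_pi; apply/andP; split; move: zE; lra.
  by rewrite sz ltxx.
- by apply/eqP; rewrite -subr_eq0 zE z0 mul0rn.
Qed.

Lemma angle_surj (x y : R) : x ^+ 2 + y ^+ 2 = 1 ->
  exists2 t, 0 <= t <= pi *+ 2 & cos t = x /\ sin t = y.
Proof.
move=> xy; have x1 : -1 <= x <= 1.
  by rewrite -ler_norml -(@expr_le1 _ 2) // real_normK ?num_real // -xy lerDl sqr_ge0.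
have c : cos (acos x) = x by rewrite acosK // in_itv.
have s : sin (acos x) = `|y| by rewrite sin_acos // -sqrtr_sqr -xy addrAC subrr add0r.
have a0 := acos_ge0 x1; have ap := acos_lepi x1.
have [y0|y0] := leP 0 y.
- exists (acos x); first by apply/andP; split; lra.
  by split=> //; rewrite s ger0_norm.
- exists (pi *+ 2 - acos x); first by apply/andP; split; lra.
  rewrite cosB sinB cos2pi sin2pi !mul1r !mul0r addr0 sub0r c s ltr0_norm // opprK.
  by [].
Qed.
End Angle.

Section PolygonCircle.
Variables (R : realType) (V : choiceType) (K : complex V) (c : V) (p : seq V).
Let cl := c :: rcons p c.
Let n := (size p).+1.
Hypothesis p2 : (2 <= size p)%N.
Hypothesis ucl : uniq (c :: p).
Hypothesis Kedge : forall i, (i < n)%N -> K [fset nth c cl i; nth c cl i.+1]%fset.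
Hypothesis Ksub : forall s, K s -> exists2 i, (i < n)%N &
  (s `<=` [fset nth c cl i; nth c cl i.+1])%fset.

Lemma nth_cl i : (i < n)%N -> nth c cl i = nth c (c :: p) i.
Proof. by rewrite /cl -rcons_cons nth_rcons /= => ->. Qed.

Lemma nth_cl_inj i j : (i < n)%N -> (j < n)%N -> nth c cl i = nth c cl j -> i = j.
Proof.
by move=> si sj; rewrite !nth_cl // => /eqP; rewrite nth_uniq // => /eqP.
Qed.

Lemma nth_cl_last : nth c cl n = c.
Proof. by rewrite /cl /n /= nth_rcons ltnn eqxx. Qed.

Lemma nth_cl_succ i j : (i < n)%N -> (j < n)%N -> nth c cl i.+1 = nth c cl j ->
  i.+1 = j \/ (i.+1 = n /\ j = 0%N).
Proof.
move=> si sj; have [E|/negP] := boolP (i.+1 == n).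
  rewrite (eqP E) nth_cl_last => H; right; split=> //; symmetry.
  exact: (nth_cl_inj (i := 0%N)).
move=> ne; left; apply: nth_cl_inj => //; lia.
Qed.

(** Walking once around the polygon and turning once around the circle at constant speed are two
quotient maps of one interval, and both identify exactly its end points. *)
Lemma polygon_circle : homeomorphic_to_circle R (realization R V K).
Proof.
have szr : size (rcons p c) = n by rewrite size_rcons.
have ep : edge_path K c cl by move=> i; rewrite /= szr ltnS => /Kedge.
have [|h [Eh ch sh]] := edge_path_param R (a0 := c) (a := c) (s := rcons p c) _ ep.
  by rewrite szr.
rewrite szr in Eh ch sh.
have n0 : 0 < n%:R :> R by rewrite ltr0n.
pose w : R := pi *+ 2 / n%:R.
have pi0 := pi_gt0 R.
have w0 : 0 < w by rewrite divr_gt0 // pmulrn_lgt0.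
have wn : w * n%:R = pi *+ 2 by rewrite divfK ?gt_eqF.
pose e (t : R) := (cos (w * t), sin (w * t)).
have hE i t v : (i < n)%N -> i%:R <= t <= i.+1%:R -> h t v =
    (1 - (t - i%:R)) * delta R (nth c cl i) v + (t - i%:R) * delta R (nth c cl i.+1) v.
  move=> si it; rewrite Eh; first by apply: path_coord_segment; rewrite ?szr.
  have /andP[t1 t2] := it; apply/andP; split; first exact: le_trans t1.
  by apply: le_trans t2 _; rewrite ler_nat.
have floor (t : R) : 0 <= t < n%:R -> exists2 i, (i < n)%N & i%:R <= t < i.+1%:R.
  move=> /andP[t0 tn]; have [//||i si /andP[t1 t2]] := @nat_interval_cover R t n; first by rewrite t0 ltW.
  have [lt|le] := ltP t i.+1%:R; first by exists i => //; rewrite t1.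
  have E : t = i.+1%:R by apply/le_anti/andP.
  exists i.+1; first by rewrite -(ltr_nat R) -E.
  by rewrite E lexx ltr_nat ltnSn.
have ne i : (i < n)%N -> nth c cl i.+1 != nth c cl i.
  by move=> si; apply/eqP => /(nth_cl_succ si si); lia.
have hinj (t t' : R) : 0 <= t < n%:R -> 0 <= t' < n%:R -> h t = h t' -> t = t'.
  move=> /floor[i si it] /floor[j sj jt] E.
  have it' : i%:R <= t <= i.+1%:R by case/andP: it => -> /ltW ->.
  have jt' : j%:R <= t' <= j.+1%:R by case/andP: jt => -> /ltW ->.
  have hv v : h t v = h t' v by rewrite E.
  have [Eij|/eqP nij] := eqVneq i j.
    subst j; have := hv (nth c cl i); rewrite !(hE i) // /delta eqxx (negPf (ne i si)) /=; lra.
  have nn : nth c cl i != nth c cl j by apply/eqP => /(nth_cl_inj si sj).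
  have i1 : nth c cl j.+1 = nth c cl i.
    apply/eqP/negPn/negP => nji; have := hv (nth c cl i).
    rewrite (hE i) // (hE j) // /delta eqxx (negPf (ne i si)) (negPf nji).
    rewrite (eq_sym (nth c cl j)) (negPf nn) /=; case/andP: it; rewrite -natr1; lra.
  have j1 : nth c cl i.+1 = nth c cl j.
    apply/eqP/negPn/negP => nji; have := hv (nth c cl j).
    rewrite (hE i) // (hE j) // /delta eqxx (negPf (ne j sj)) (negPf nji).
    rewrite (negPf nn) /=; case/andP: jt; rewrite -natr1; lra.
  have := nth_cl_succ sj si i1; have := nth_cl_succ si sj j1; move: p2; rewrite /n; lia.
have hend : h n%:R = h 0.
  apply: bary_inj => v.
  have -> := hE 0%N 0 v (ltn0Sn _); last by rewrite lexx ler01.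
  have -> := hE n.-1 n%:R v (ltnSn _); last by rewrite lexx ler_nat leqnSn.
  rewrite nth_cl_last /= -natr1 /cl /=; set d := delta R c v.
  have -> : (size p)%:R + 1 - (size p)%:R = 1 :> R by lra.
  lra.
have eend : e n%:R = e 0 by rewrite /e wn mulr0 cos2pi sin2pi cos0 sin0.
have einj (t t' : R) : 0 <= t < n%:R -> 0 <= t' < n%:R -> e t = e t' -> t = t'.
  move=> t0 t0' [Ec Es]; have : w * t = w * t'.
    have win x : 0 <= x < n%:R -> 0 <= w * x < pi *+ 2.
      by case/andP=> x0 xn; rewrite -wn ltr_pM2l // xn mulr_ge0 // ltW.
    by apply: angle_inj => //; exact: win.
  by move/mulfI; apply; rewrite gt_eqF.
(* Both maps are injective on the half-open interval, to which the end point is moved. *)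
pose red (t : R) := if t == n%:R then 0 else t.
have red_in t : 0 <= t <= n%:R -> 0 <= red t < n%:R.
  by rewrite /red => /andP[t0 tn]; case: eqP => [_|/eqP H]; rewrite ?lexx // t0 lt_neqAle H.
have hred t : h (red t) = h t by rewrite /red; case: eqP => // ->.
have ered t : e (red t) = e t by rewrite /red; case: eqP => // ->.
have he t t' : 0 <= t <= n%:R -> 0 <= t' <= n%:R -> h t = h t' -> e t = e t'.
  by move=> /red_in H /red_in H'; rewrite -hred -(hred t') => /(hinj _ _ H H') E; rewrite -ered E ered.
have eh t t' : 0 <= t <= n%:R -> 0 <= t' <= n%:R -> e t = e t' -> h t = h t'.
  by move=> /red_in H /red_in H'; rewrite -ered -(ered t') => /(einj _ _ H H') E; rewrite -hred E hred.
have hsurj (y : realization R V K) : exists2 t, 0 <= t <= n%:R & h t = y.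
  have [s [Ks sy sum1]] := bary_supp y.
  have [i si sub] := Ksub Ks.
  set a := nth c cl i in sub; set b := nth c cl i.+1 in sub.
  have ab : a != b by rewrite eq_sym ne.
  have sy' : supported [fset a; b]%fset y.
    by move=> v vab; apply: sy; apply: contra vab; exact: (fsubsetP sub).
  have yab : y a + y b = 1.
    have := sum1; rewrite (big_fset_incl _ sub) /=; last by move=> v _ /sy.
    by rewrite big_fsetU1 ?inE //= big_seq_fset1.
  have y0 := bary_ge0 y a; have y1 := bary_ge0 y b.
  have it : i%:R <= i%:R + y b <= i.+1%:R by rewrite -natr1; apply/andP; split; lra.
  exists (i%:R + y b).
    case/andP: it => t1 t2; apply/andP; split; first exact: le_trans t1.
    by apply: le_trans t2 _; rewrite ler_nat.
  apply: bary_inj => v; rewrite (hE i) // -/a -/b /delta.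
  have [<-|va] := eqVneq a v; first by rewrite eq_sym (negPf ab) /=; lra.
  have [<-|vb] := eqVneq b v; first by rewrite /=; lra.
  by rewrite !mulr0 addr0 sy' // !inE negb_or eq_sym va eq_sym vb.
have esurj q : circle R q -> exists2 t, 0 <= t <= n%:R & e t = q.
  case: q => x y; rewrite /circle /= => /angle_surj[t /andP[t0 t2] [<- <-]].
  exists (t / w).
    by rewrite divr_ge0 ?(ltW w0) //= ler_pdivrMr // mulrC wn.
  by rewrite /e mulrC divfK ?gt_eqF.
have : forall y : realization R V K, exists t, 0 <= t <= n%:R /\ h t = y.
  by move=> y; have [t t0 E] := hsurj y; exists t.
move/choice=> [T HT].
have : forall q, exists t, circle R q -> 0 <= t <= n%:R /\ e t = q.
  move=> q; have [/esurj[t t0 E]|nq] := pselect (circle R q); first by exists t.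
  by exists 0.
move/choice=> [T' HT'].
have cI : compact `[0, n%:R : R]%classic by exact: segment_compact.
have ce : continuous e.
  move=> t; have cw : {for t, continuous (fun u => w * u)}.
    by apply: continuousM; [exact: cst_continuous|move=> ?].
  have H1 : cos (w * u) @[u --> t] --> cos (w * t).
    by apply: (continuous_comp cw); exact: continuous_cos.
  have H2 : sin (w * u) @[u --> t] --> sin (w * t).
    by apply: (continuous_comp cw); exact: continuous_sin.
  exact: (cvg_pair H1 H2).
have ce' : {within `[0, n%:R : R], continuous e} by exact: continuous_subspaceT.
exists (e \o T), (h \o T'); split.
- apply/continuous_subspace_setT.
  apply: (quotient_continuous cI (@realization_hausdorff R V K) ch ce').
    apply/seteqP; split=> // y _; exists (T y); last exact: (HT y).2.
    by rewrite /= in_itv /=; exact: (HT y).1.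
  move=> t; rewrite /= in_itv /= => t0; apply: he => //; first exact: (HT _).1.
  exact: (HT _).2.
- apply: (quotient_continuous cI _ ce' ch).
  + exact: (@norm_hausdorff R (R * R)%type).
  + apply/seteqP; split=> [q cq|q [t _ <-]].
      exists (T' q); last exact: (HT' q cq).2.
      by rewrite /= in_itv /=; exact: (HT' q cq).1.
    by rewrite /circle /= cos2Dsin2.
  + move=> t; rewrite /= in_itv /= => t0.
    have cet : circle R (e t) by rewrite /circle /= cos2Dsin2.
    by apply: eh => //; [exact: (HT' _ cet).1|exact: (HT' _ cet).2].
- by move=> y /=; rewrite /circle /= cos2Dsin2.
- move=> y /=; have cet : circle R (e (T y)) by rewrite /circle /= cos2Dsin2.
  rewrite -[RHS](HT y).2; apply: eh; [exact: (HT' _ cet).1|exact: (HT y).1|exact: (HT' _ cet).2].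
- move=> q cq /=; rewrite -[RHS](HT' q cq).2; apply: he; [exact: (HT _).1|exact: (HT' q cq).1|exact: (HT _).2].
Qed.
End PolygonCircle.

(** * Closed walks in links *)

Section EsumSeq.
Variables (R : realType) (T : choiceType) (D : set T) (a : T -> R).

Lemma esum_le_seq (r : seq T) : (forall t, t \in r -> 0 <= a t) ->
  (forall t, D t -> t \in r) -> (\esum_(t in D) (a t)%:E <= (\sum_(t <- r) a t)%:E)%E.
Proof.
move=> a0 Dr; apply: ge_ereal_sup => _ [X [finX XD] <-].
apply: (@le_trans _ _ (\sum_(t \in [set` undup r]) (a t)%:E)%E).
  apply: lee_fsum_nneg_subset => //.
  - by move=> t; rewrite !inE => /XD/Dr; rewrite /= mem_undup.
  - by move=> t /andP[_]; rewrite inE /= mem_undup lee_fin => /a0.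
rewrite -fsbig_seq ?undup_uniq // sumEFin lee_fin.
elim: r a0 {Dr} => //= x r IH a0.
have {}IH : \sum_(t <- undup r) a t <= \sum_(t <- r) a t.
  by apply: IH => t tr; apply: a0; rewrite inE tr orbT.
have ax : 0 <= a x by apply: a0; rewrite inE eqxx.
by case: ifP => _; rewrite !big_cons; lra.
Qed.

Lemma esum_ge_seq (r : seq T) : uniq r -> (forall t, t \in r -> D t) ->
  ((\sum_(t <- r) a t)%:E <= \esum_(t in D) (a t)%:E)%E.
Proof.
move=> ur rD; apply: esum_ge; exists [set` r]; last by rewrite -fsbig_seq // sumEFin.
by split; [exact: finite_seq|move=> t /= /rD].
Qed.
End EsumSeq.

Lemma take_nth_drop2 (T : Type) (x0 : T) s i j : (i < j < size s)%N ->
  exists P, s = take i s ++ nth x0 s i :: P ++ nth x0 s j :: drop j.+1 s /\ size P = (j - i.+1)%N.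
Proof.
move=> /andP[ij js]; exists (take (j - i.+1) (drop i.+1 s)); split; last first.
  by rewrite size_takel // size_drop; lia.
rewrite -[LHS](cat_take_drop i); congr (_ ++ _).
rewrite (drop_nth x0); last by lia.
congr (_ :: _); rewrite -[LHS](cat_take_drop (j - i.+1)); congr (_ ++ _).
by rewrite drop_drop -(drop_nth x0) //; congr drop; lia.
Qed.

Lemma mem_darts (V : choiceType) (x0 : V) s i : sorted (fun a b => a != b) s ->
  (i.+1 < size s)%N -> (nth x0 s i, nth x0 s i.+1) \in darts s.
Proof.
elim: s i => [|a [|b s] IH] // [|i] /= /andP[/negPf ab p]; rewrite ab ?inE ?eqxx // ltnS => si.
by apply/orP; right; exact: IH.
Qed.

Lemma darts_nth (V : choiceType) (x0 : V) s a b : sorted (fun a b => a != b) s ->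
  (a, b) \in darts s -> exists2 i, (i.+1 < size s)%N & a = nth x0 s i /\ b = nth x0 s i.+1.
Proof.
elim: s => [|c [|d s] IH] //= /andP[/negPf cd p]; rewrite cd inE => /orP[/eqP[-> ->]|].
  by exists 0%N.
by move/(IH p) => [i si E]; exists i.+1.
Qed.

Section FullCycle.
Variables (R : realType) (V : choiceType) (L : length_complex R V) (c : V) (p : seq V).
Hypothesis lgL : large L.
Let cl := c :: rcons p c.
Let n := (size p).+1.
Hypothesis p3 : (3 <= size p)%N.
Hypothesis ew : edge_walk L cl.
Hypothesis chordless : forall A u P v B, c :: p = A ++ u :: P ++ v :: B -> P != [::] ->
     (A != [::]) || (B != [::]) -> u <> v /\ ~ L [fset u; v]%fset.

(** The faces of the edges of the closed walk cl. *)
Definition polygon_simplex (s : {fset V}) := s != fset0 /\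
  exists2 i, (i < n)%N & (s `<=` [fset nth c cl i; nth c cl i.+1])%fset.

Fact polygon_face s t : polygon_simplex s -> t != fset0 -> (t `<=` s)%fset -> polygon_simplex t.
Proof. by move=> [_ [i si sub]] t0 ts; split=> //; exists i => //; exact: fsubset_trans sub. Qed.

Definition polygon : complex V := Complex (fun s => @proj1 _ _) polygon_face.

Lemma size_cl : size cl = n.+1. Proof. by rewrite /cl /= size_rcons. Qed.

Lemma cl_neq i : (i < n)%N -> nth c cl i != nth c cl i.+1.
Proof.
by move=> si; case: ew => srt _; apply: (sortedP c srt); rewrite size_cl.
Qed.

Lemma cl_edge i : (i < n)%N -> L [fset nth c cl i; nth c cl i.+1]%fset.
Proof. by move=> si; case: ew => srt; apply; apply: mem_darts => //; rewrite size_cl. Qed.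

Lemma far_apart i j : (i.+1 < j)%N -> (j < n)%N -> (i == 0)%N && (j == n.-1) = false ->
  nth c cl i <> nth c cl j /\ ~ L [fset nth c cl i; nth c cl j]%fset.
Proof.
move=> ij jn Eij; have [|P [EP sP]] := @take_nth_drop2 _ c (c :: p) i j.
  by rewrite /= jn andbT ltnW.
rewrite /cl -!rcons_cons !nth_rcons /= !ifT //; last by lia.
apply: chordless EP _ _; first by rewrite -size_eq0 sP; lia.
move: Eij; rewrite -!size_eq0 size_takel; last by rewrite /=; lia.
by rewrite size_drop /= /n; lia.
Qed.

Lemma cl_uniq : uniq (c :: p).
Proof.
apply/(uniqPn c) => -[i [j [ij jn]]] E.
have nE k : (k < n)%N -> nth c cl k = nth c (c :: p) k.
  by move=> kn; rewrite /cl -rcons_cons nth_rcons /= kn.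
rewrite -!nE // in E; last by rewrite /n; move: jn => /=; lia.
have [ij1|ij1] := leqP j i.+1.
  have Ej : j = i.+1 by lia.
  have := cl_neq (i := i); rewrite -Ej E eqxx => H; apply/notF/H.
  by move: jn => /=; rewrite /n; lia.
have [/andP[/eqP i0 /eqP jn1]|/negbTE b] := boolP ((i == 0)%N && (j == n.-1)); last first.
  exact: (far_apart ij1 jn b).1 E.
have := cl_neq (i := j); rewrite -E i0; have -> : j.+1 = n by rewrite jn1 /n.
rewrite {1}/cl /= nth_rcons ltnn eqxx eqxx => H; exact/notF/H.
Qed.

Lemma polygon_cycle : Defs.cycle R polygon L.
Proof.
split.
  move=> s [s0 [i si sub]]; exact: (simplex_face (cl_edge si)).
apply: (@polygon_circle R V polygon c p); [by lia|exact: cl_uniq| |by move=> s []].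
move=> i si; split; last by exists i.
by apply/fset0Pn; exists (nth c cl i); rewrite !inE eqxx.
Qed.

Lemma polygon_vertex v : vertex polygon v -> exists2 i, (i < n)%N & v = nth c cl i.
Proof.
case=> _ [i si]; rewrite fsub1set !inE => /orP[]/eqP->; first by exists i.
have [E|ne] := eqVneq i.+1 n; last by exists i.+1 => //; lia.
by exists 0%N => //; rewrite E /cl /= nth_rcons ltnn eqxx.
Qed.

(** With at least four vertices, no three of them are pairwise consecutive. *)
Lemma polygon_full : full polygon L.
Proof.
move=> s Ls vs; have s0 := simplex_neq0 Ls; split=> //.
have near i j : (i < n)%N -> (j < n)%N -> nth c cl i \in s -> nth c cl j \in s -> (i < j)%N ->
    j = i.+1 \/ (i = 0%N /\ j = n.-1).
  move=> si sj is_ js ij; have [|ij1] := leqP j i.+1; first by left; lia.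
  have [/andP[/eqP -> /eqP ->]|/negbTE b] := boolP ((i == 0)%N && (j == n.-1)); first by right.
  have [_] := far_apart ij1 sj b; case.
  exact: simplex_sub2 Ls is_ js.
have wrap i : (i < n)%N -> exists2 k, (k < n)%N & nth c cl i.+1 = nth c cl k /\
    (k = i.+1 \/ i = n.-1 /\ k = 0%N).
  move=> si; have [E|ne] := eqVneq i.+1 n; last by exists i.+1; [lia|split; [|left]].
  exists 0%N => //; split; last by right; rewrite -E.
  by rewrite E /cl /= nth_rcons ltnn eqxx.
case/fset0Pn: (s0) => x xs; have [i si Ei] := polygon_vertex (vs _ xs); subst x.
have [[i' si' [Hi Hi1]]|no] := pselect (exists2 i', (i' < n)%N &
    nth c cl i' \in s /\ nth c cl i'.+1 \in s).
  exists i' => //; apply/fsubsetP => y ys; have [j sj Ej] := polygon_vertex (vs _ ys); subst y.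
  have [k sk [Ek kk]] := wrap i' si'.
  rewrite !inE Ek; rewrite Ek in Hi1.
  have [->|ji] := eqVneq j i'; first by rewrite eqxx.
  have [->|jk] := eqVneq j k; first by rewrite eqxx orbT.
  exfalso; have := near _ _ sj si' ys Hi; have := near _ _ si' sj Hi ys.
  have := near _ _ sj sk ys Hi1; have := near _ _ sk sj Hi1 ys.
  move: ji jk p3 sj si' sk; rewrite /n => /eqP ? /eqP ? ? ? ? ?.
  by case: kk => [?|[? ?]]; lia.
exists i => //; apply/fsubsetP => y ys; have [j sj Ej] := polygon_vertex (vs _ ys); subst y.
have [->|ji] := eqVneq j i; first by rewrite !inE eqxx.
exfalso; apply: no.
have adj a b : (a < n)%N -> (b < n)%N -> nth c cl a \in s -> nth c cl b \in s -> (a < b)%N ->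
    exists2 i', (i' < n)%N & nth c cl i' \in s /\ nth c cl i'.+1 \in s.
  move=> sa sb as_ bs ab; case: (near _ _ sa sb as_ bs ab) => [E|[E1 E2]].
    by exists a => //; rewrite -E.
  exists b => //; split=> //; have [k sk [-> [E|[_ ->]]]] := wrap b sb; last by rewrite -E1.
  by exfalso; move: sk; rewrite E E2 /n /= ltnn.
by case: (ltngtP i j) => ij; [exact: (adj i j)|exact: (adj j i)|rewrite ij eqxx in ji].
Qed.

(** The hypothesis [chordless] makes the polygon a full subcomplex. *)
Lemma full_cycle_walk_len : 2 <= walk_len L cl.
Proof.
have := lgL.2 _ polygon_cycle polygon_full.
have [srt He] := ew.
rewrite -lee_fin => /le_trans; apply.
have -> : walk_len L cl = \sum_(e <- [seq [fset f.1; f.2]%fset | f <- darts cl]) len L e.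
  by rewrite big_map.
apply: esum_le_seq.
  move=> _ /mapP[[a b] ab ->]; have [i si [Ea Eb]] := darts_nth c srt ab.
  rewrite size_cl in si; have := cl_neq si; rewrite -Ea -Eb => nab.
  by have /andP[] := edge_len_bounds nab (He _ _ ab).
move=> e [[e0 [i si sub]] e2]; apply/mapP.
exists (nth c cl i, nth c cl i.+1); first by apply: mem_darts; rewrite ?size_cl.
by apply/eqP; rewrite eqEfcard sub /= e2 cardfs2 cl_neq.
Qed.
End FullCycle.

Section Link.
Variables (R : realType) (V : choiceType) (X : length_complex R V).

(** Triangles of the link of x are triangles of X. *)
Lemma short_link_filling x c (p : seq V) : large (length_link X x) ->
  chain (triangle X x) c (rcons p c) -> path_len X c (rcons p c) < 2 ->
  filling X (c :: rcons p c) (size p).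
Proof.
move=> [fl hc] ch lt2; pose L := length_link X x.
have link_edge a b : triangle X x a b -> L [fset a; b]%fset.
  move=> t; case: (t) => xa ab bx H; split.
  - exact: triangle_edge (triangle_rot t).
  - by rewrite !inE negb_or xa eq_sym bx.
  - by rewrite fsetUA.
have link_triangle a b d : triangle L a b d -> triangle X a b d.
  by case=> ab bd da [H _ _].
have ew : edge_walk L (c :: rcons p c).
  suff H s a : chain (triangle X x) a s -> edge_walk L (a :: s) by exact: H.
  elim: s a => [|b s IH] a /=; first by [].
  case=> t /IH[srt He]; case: (t) => _ ab _ _; split; first by rewrite /= ab.
  move=> u v; rewrite /= (negPf ab) inE => /orP[/eqP[-> ->]|/He //].
  exact: link_edge.
have mono s m : filling L s m -> filling X s m.
  rewrite /filling; elim=> {s m} [m|P d Q m _|P d Q m _|P f g h Q m [E1 E2 E3 t] _].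
  - exact: fill_nil.
  - exact: fill_spur.
  - exact: fill_unspur.
  - by apply: fill_rel; split=> //; exact: link_triangle.
have wl : walk_len L (c :: rcons p c) < 2.
  have H s a : path_len L a s = path_len X a s by elim: s a => //= b s IH a; rewrite IH.
  by have [srt _] := ew; rewrite walk_len_path // H.
have p1 : (1 <= size p)%N by case: p ch {lt2 ew wl} => //= -[[_ ]]; rewrite eqxx.
have [|F _] := polygon_filling fl (fun c p p3 ew nc => full_cycle_walk_len (conj fl hc) p3 ew nc)
   erefl _ (last_rcons _ _ _) ew wl.
  by rewrite size_rcons.
by apply: filling_weak (mono _ _ F); rewrite size_rcons; case: (p) p1 => //= ? ?; rewrite subn2.
Qed.
End Link.

(** * Complexes homeomorphic to the circle *)

Lemma within_comp (T U W : topologicalType) (A : set T) (B : set U) (h : T -> U) (f : U -> W) :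
  {within A, continuous h} -> {within B, continuous f} -> (forall t, A t -> B (h t)) ->
  {within A, continuous (f \o h)}.
Proof.
move=> /subspace_continuousP ch /subspace_continuousP cf AB; apply/subspace_continuousP => t At W' nW.
have H : nbhs (h t) [set x | B x -> W' (f x)] := cf _ (AB _ At) _ nW.
have H2 : nbhs t [set x | A x -> B (h x) -> W' (f (h x))] := ch _ At _ H.
by apply: filterS H2 => x Hx Ax; apply: Hx => //; exact: AB.
Qed.

Section CircleSpace.
Variables (R : realType) (V : choiceType) (K : complex V).
Notation geom := (realization R V K).
Variables (f : geom -> R * R) (g : R * R -> geom).
Hypotheses (cf : continuous f) (cg : {within circle R, continuous g}).
Hypotheses (fS : forall x, circle R (f x)) (fK : forall x, g (f x) = x).
Hypothesis gK : forall p, circle R p -> f (g p) = p.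

Lemma vertex_point v : vertex K v -> exists y : geom, forall u, y u = delta R v u.
Proof.
move=> Kv; have [||y [Ey _]] := @segment_point R _ K v v 0; first by rewrite fsetUid.
  by rewrite lexx ler01.
by exists y => u; rewrite Ey; lra.
Qed.

(** The rotation of p by the angle t.  As t runs through one turn, it covers the circle starting
and ending at p. *)
Definition rot (p : R * R) (t : R) := (p.1 * cos t - p.2 * sin t, p.2 * cos t + p.1 * sin t).

Lemma rot_circle p t : circle R p -> circle R (rot p t).
Proof.
rewrite /circle /rot /= => Hp.
have := cos2Dsin2 t; set c := cos t; set s := sin t => Ht.
transitivity ((p.1 ^+ 2 + p.2 ^+ 2) * (c ^+ 2 + s ^+ 2)); first by ring.
by rewrite Hp Ht mulr1.
Qed.

Lemma rot_surj p z : circle R p -> circle R z -> exists2 t, 0 <= t <= pi *+ 2 & rot p t = z.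
Proof.
case: p z => p1 p2 [z1 z2]; rewrite /circle /rot /= => Hp Hz.
have [|t t0 [Ec Es]] := @angle_surj R (z1 * p1 + z2 * p2) (p1 * z2 - p2 * z1).
  transitivity ((p1 ^+ 2 + p2 ^+ 2) * (z1 ^+ 2 + z2 ^+ 2)); first by ring.
  by rewrite Hp Hz mulr1.
exists t => //; rewrite Ec Es; congr pair.
  by transitivity ((p1 ^+ 2 + p2 ^+ 2) * z1); [ring|rewrite Hp mul1r].
by transitivity ((p1 ^+ 2 + p2 ^+ 2) * z2); [ring|rewrite Hp mul1r].
Qed.

Lemma rot_fix p t : circle R p -> 0 < t < pi *+ 2 -> rot p t <> p.
Proof.
case: p => p1 p2; rewrite /circle /rot /= => Hp /andP[t0 t2] [E1 E2].
suff E : t = 0 by rewrite E ltxx in t0.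
apply: angle_inj; rewrite ?t2 ?(ltW t0) //.
- by rewrite lexx pmulrn_lgt0 // pi_gt0.
- rewrite cos0 -[LHS]mul1r -{1}Hp.
  transitivity (p1 * (p1 * cos t - p2 * sin t) + p2 * (p2 * cos t + p1 * sin t)); first by ring.
  by rewrite E1 E2 -!expr2.
- rewrite sin0 -[LHS]mul1r -{1}Hp.
  transitivity (p1 * (p2 * cos t + p1 * sin t) - p2 * (p1 * cos t - p2 * sin t)); first by ring.
  by rewrite E1 E2; ring.
Qed.

Lemma rot_continuous p : continuous (rot p).
Proof.
move=> t.
have H1 : p.1 * cos u - p.2 * sin u @[u --> t] --> p.1 * cos t - p.2 * sin t.
  by apply: cvgB; apply: cvgM; [exact: cvg_cst|exact: continuous_cos|exact: cvg_cst|exact: continuous_sin].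
have H2 : p.2 * cos u + p.1 * sin u @[u --> t] --> p.2 * cos t + p.1 * sin t.
  by apply: cvgD; apply: cvgM; [exact: cvg_cst|exact: continuous_cos|exact: cvg_cst|exact: continuous_sin].
exact: (cvg_pair H1 H2).
Qed.

Lemma wrap_continuous p : circle R p -> continuous (g \o rot p).
Proof.
move=> cp; apply/continuous_subspace_setT; apply: within_comp cg _.
  by apply: continuous_subspaceT; exact: rot_continuous.
by move=> t _; exact: rot_circle.
Qed.

Lemma wrap_surj p y : circle R p -> exists2 t, 0 <= t <= pi *+ 2 & g (rot p t) = y.
Proof. by move=> cp; have [t t0 E] := rot_surj cp (fS y); exists t; rewrite ?E. Qed.

Lemma positive_coord (y : geom) : exists v, 0 < y v.
Proof.
have [s [Ks sy sum1]] := bary_supp y.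
apply: contrapT => no; move: (sum1); rewrite big1_seq => [/esym/eqP|v /= vs].
  by rewrite oner_eq0.
by apply/eqP; rewrite eq_le (bary_ge0 y) andbT leNgt; apply/negP => v0; apply: no; exists v.
Qed.

(** The open stars of the vertices cover the compact realization, and a vertex lies in no star but
its own. *)
Lemma finite_vertices : exists D : {fset V}, forall v, vertex K v -> v \in D.
Proof.
have p1 : circle R (1, 0) by rewrite /circle /= expr1n expr0n /= addr0.
have := @segment_compact R 0 (pi *+ 2); rewrite compact_cover.
move=> /(_ V setT (fun v => [set t : R | 0 < (g (rot (1, 0) t)) v])).
case=> [v _|t _|D _ sub].
- have /continuousP cw := wrap_continuous p1.
  exact: cw _ (@coord_open R V K v [set x | 0 < x] (@open_gt R 0)).
- by have [v v0] := positive_coord (g (rot (1, 0) t)); exists v.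
exists D => v Kv; have [y Ey] := vertex_point Kv.
have [t t0 Et] := wrap_surj y p1.
have [|u /= uD] := sub t; first by rewrite /= in_itv.
by rewrite Et Ey /delta; case: eqP => [->|_]; rewrite ?ltxx.
Qed.

Definition cross (u w : R * R) := u.1 * w.2 - u.2 * w.1.

(** A line meets the circle in at most two points. *)
Lemma chord_only (p x z : R * R) : circle R p -> circle R x -> circle R z -> z <> p ->
  cross (x - p) (z - p) = 0 -> x = p \/ x = z.
Proof.
case: p x z => p1 p2 [x1 x2] [z1 z2]; rewrite /circle /cross /= => Hp Hx Hz zp E.
pose a := x1 - p1; pose b := x2 - p2; pose d := z1 - p1; pose e := z2 - p2.
have Ha : a ^+ 2 + b ^+ 2 + 2 * (p1 * a + p2 * b) = 0.
  transitivity ((x1 ^+ 2 + x2 ^+ 2) - (p1 ^+ 2 + p2 ^+ 2)); first by rewrite /a /b; ring.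
  by rewrite Hx Hp subrr.
have Hd : d ^+ 2 + e ^+ 2 + 2 * (p1 * d + p2 * e) = 0.
  transitivity ((z1 ^+ 2 + z2 ^+ 2) - (p1 ^+ 2 + p2 ^+ 2)); first by rewrite /d /e; ring.
  by rewrite Hz Hp subrr.
have {}E : a * e = b * d by apply/eqP; rewrite -subr_eq0; apply/eqP.
pose D := d ^+ 2 + e ^+ 2; pose k := a * d + b * e.
have Da : D * a = k * d.
  by transitivity (a * d * d + (a * e) * e); [rewrite /D; ring|rewrite E /k; ring].
have Db : D * b = k * e.
  by transitivity ((b * d) * d + b * e * e); [rewrite /D; ring|rewrite -E /k; ring].
have D0 : D != 0.
  rewrite /D paddr_eq0 ?sqr_ge0 // !sqrf_eq0 !subr_eq0.
  by apply/negP => /andP[/eqP E1 /eqP E2]; apply: zp; rewrite E1 E2.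
have kk : k * (k - D) = 0.
  apply: (mulfI D0); rewrite mulr0.
  transitivity ((D * a) ^+ 2 + (D * b) ^+ 2 + 2 * D * (p1 * (D * a) + p2 * (D * b))); last first.
    transitivity (D ^+ 2 * (a ^+ 2 + b ^+ 2 + 2 * (p1 * a + p2 * b))); first by ring.
    by rewrite Ha mulr0.
  rewrite Da Db.
  transitivity (k ^+ 2 * D + k * D * (2 * (p1 * d + p2 * e))); last by rewrite /D; ring.
  have -> : 2 * (p1 * d + p2 * e) = - D by apply/eqP; rewrite -addr_eq0 addrC /D; apply/eqP.
  ring.
have [k0|kD] : k = 0 \/ k = D.
  by move/eqP: kk; rewrite mulf_eq0 subr_eq0 => /orP[]/eqP; [left|right].
- left; rewrite k0 !mul0r in Da Db; move/eqP: Da; rewrite mulf_eq0 (negPf D0) subr_eq0 => /eqP ->.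
  by move/eqP: Db; rewrite mulf_eq0 (negPf D0) subr_eq0 => /eqP ->.
- right; rewrite kD in Da Db; move/(mulfI D0)/addIr: Da => ->.
  by move/(mulfI D0)/addIr: Db => ->.
Qed.

Lemma f_inj x y : f x = f y -> x = y.
Proof. by move=> E; rewrite -[x]fK E fK. Qed.

(** The segment from A to C avoids q and B, so its image in the circle does not cross the line
through the images of q and B. *)
Lemma same_side (q A B C : geom) a b c : a != b -> b != c -> K [fset a; c]%fset ->
  0 < q b -> (forall u, A u = delta R a u) -> (forall u, B u = delta R b u) ->
  (forall u, C u = delta R c u) -> q <> B ->
  0 < cross (f A - f q) (f B - f q) * cross (f C - f q) (f B - f q).
Proof.
move=> ab bc Kac qb EA EB EC qB.
have ep : edge_path K a [:: a; c] by case.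
have [//|h [Eh ch _]] := edge_path_param R (a := a) (s := [:: c]) _ ep.
rewrite /= in Eh ch.
have hb t : 0 <= t <= 1 -> h t b = 0.
  move=> /andP[t0 t1]; rewrite Eh ?t0 //= t1 /delta (negPf ab) (eq_sym c) (negPf bc).
  by rewrite !mulr0 addr0.
have h0 : h 0 = A by apply: bary_inj => v; rewrite Eh ?lexx ?ler01 //= ?ler01 EA; lra.
have h1 : h 1 = C by apply: bary_inj => v; rewrite Eh ?lexx ?ler01 //= ?lexx EC; lra.
pose F t := cross (f (h t) - f q) (f B - f q).
have F0 t : 0 <= t <= 1 -> F t <> 0.
  move=> t01; case/chord_only; rewrite ?fS //.
  - by move/f_inj => E; apply: qB.
  - by move/f_inj => E; move: qb; rewrite -E hb // ltxx.
  - move/f_inj => E; have := hb t t01; rewrite E EB /delta eqxx => /eqP; by rewrite oner_eq0.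
have cF : {within `[0, 1], continuous F}.
  have cl : continuous (fun y : geom => cross (f y - f q) (f B - f q)).
    move=> y; have c1 : (f z).1 @[z --> y] --> (f y).1 by apply: cvg_comp (cf (x := y)) _; exact: cvg_fst.
    have c2 : (f z).2 @[z --> y] --> (f y).2 by apply: cvg_comp (cf (x := y)) _; exact: cvg_snd.
    have d1 : (f z).1 - (f q).1 @[z --> y] --> (f y).1 - (f q).1 by apply: cvgB c1 _; exact: cvg_cst.
    have d2 : (f z).2 - (f q).2 @[z --> y] --> (f y).2 - (f q).2 by apply: cvgB c2 _; exact: cvg_cst.
    exact: cvgB (cvgM d1 (cvg_cst _)) (cvgM d2 (cvg_cst _)).
  apply: (@within_comp _ _ _ _ setT h (fun y : geom => cross (f y - f q) (f B - f q)) ch) => //.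
  exact: continuous_subspaceT cl.
have : F 0 * F 1 != 0.
  by rewrite mulf_neq0 //; apply/eqP/F0; rewrite ?lexx ?ler01.
rewrite -h0 -h1 -/(F 0) -/(F 1) neq_lt => /orP[neg|//].
have [|t t01 Ft] := @IVT R F 0 1 0 ler01 cF; last first.
  by case: (F0 t) => //; move: t01; rewrite in_itv.
rewrite ge_min le_max; have [F00|F00] := ltP (F 0) 0.
  by rewrite (nmulr_rlt0 _ F00) in neg; rewrite (ltW F00) (ltW neg) orbT.
rewrite ?F00 /= andbT; apply/orP; right; rewrite leNgt; apply/negP => F10.
by move: neg; rewrite ltNge mulr_ge0 // ltW.
Qed.

(** Take for q the barycentre.  Seen from the image of q, the images of any two of the vertices
lie on the same side of the third.  The three cross products would have pairwise negative
products, which is impossible for three reals. *)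
Lemma no_triangle a b c : ~ triangle K a b c.
Proof.
move=> t; case: (t) => ab bc ca Kabc.
pose q v : R := (delta R a v + delta R b v + delta R c v) / 3.
have q0 v : 0 <= q v by rewrite /q divr_ge0 // !addr_ge0 // /delta ler0n.
have qs : exists s, [/\ K s, supported s q & \sum_(v <- s) q v = 1].
  exists [fset a; b; c]%fset; split=> //.
    move=> v; rewrite !inE !negb_or -andbA => /and3P[va vb vc].
    by rewrite /q /delta !(eq_sym _ v) (negPf va) (negPf vb) (negPf vc) /= !addr0 mul0r.
  rewrite -mulr_suml !big_split /= !delta_sum ?fset_uniq ?inE ?eqxx ?orbT //.
  by rewrite -natr1 divff // natr1 pnatr_eq0.
pose Q := Realization q0 qs.
have vx x : x \in [fset a; b; c]%fset -> vertex K x by exact: simplex_sub Kabc.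
have [|A EA] := @vertex_point a; first by apply: vx; rewrite !inE eqxx.
have [|B EB] := @vertex_point b; first by apply: vx; rewrite !inE eqxx orbT.
have [|C EC] := @vertex_point c; first by apply: vx; rewrite !inE eqxx orbT.
have E2 x y : x \in [fset a; b; c]%fset -> y \in [fset a; b; c]%fset -> K [fset x; y]%fset.
  exact: simplex_sub2 Kabc.
have ba : b != a by rewrite eq_sym.
have cb : c != b by rewrite eq_sym.
have ac : a != c by rewrite eq_sym.
have dxx x : delta R x x = 1 by rewrite /delta eqxx.
have dxy x y : x != y -> delta R x y = 0 by rewrite /delta => /negPf ->.
have Qa : Q a = 1 / 3 by rewrite /= /q dxx !dxy // !addr0.
have Qb : Q b = 1 / 3 by rewrite /= /q dxx !dxy // add0r addr0.
have Qc : Q c = 1 / 3 by rewrite /= /q dxx !dxy // !add0r.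
have [nA [nB nC]] : Q <> A /\ Q <> B /\ Q <> C.
  split; last split; move=> E.
  - by have := Qa; rewrite E EA dxx; lra.
  - by have := Qb; rewrite E EB dxx; lra.
  - by have := Qc; rewrite E EC dxx; lra.
have ma : a \in [fset a; b; c]%fset by rewrite !inE eqxx.
have mb : b \in [fset a; b; c]%fset by rewrite !inE eqxx orbT.
have mc : c \in [fset a; b; c]%fset by rewrite !inE eqxx orbT.
have third : 0 < 1 / 3 :> R by rewrite divr_gt0.
have s1 := same_side ab bc (E2 a c ma mc) (_ : 0 < Q b) EA EB EC nB.
have s2 := same_side bc ca (E2 b a mb ma) (_ : 0 < Q c) EB EC EA nC.
have s3 := same_side ca ab (E2 c b mc mb) (_ : 0 < Q a) EC EA EB nA.
rewrite Qb in s1; rewrite Qc in s2; rewrite Qa in s3.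
have {}s1 := s1 third; have {}s2 := s2 third; have {}s3 := s3 third.
have anti u w : cross u w = - cross w u by rewrite /cross; ring.
rewrite (anti (f C - _)) mulrN oppr_gt0 in s1.
rewrite (anti (f A - _) (f C - _)) mulrN oppr_gt0 in s2.
rewrite (anti (f B - _) (f A - _)) mulrN oppr_gt0 in s3.
move: s1 s2 s3; set x := cross _ _; set y := cross _ _; set z := cross _ _ => s1 s2 s3.
have : 0 < (x * y) * (y * z) by rewrite nmulr_rgt0.
rewrite ltNge => /negP; apply.
have -> : x * y * (y * z) = (z * x) * y ^+ 2 by ring.
by rewrite mulr_le0_ge0 ?sqr_ge0 // ltW.
Qed.

(** If w0 were the only possible neighbour of v, then at most one point q would have its coordinate
at v equal to 1/2.  Removing one point does not disconnect the circle: a path from v to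
another vertex that avoids q contradicts the intermediate value theorem. *)
Lemma no_leaf v w0 : vertex K v -> exists w, [/\ w != v, w != w0 & K [fset v; w]%fset].
Proof.
move=> Kv; apply: contrapT => no.
have only w : w != v -> K [fset v; w]%fset -> w = w0.
  by move=> wv Kvw; apply: contrapT => /eqP ww; apply: no; exists w.
have [y Ey] := vertex_point Kv.
have [u [uv Ku]] : exists u, u != v /\ vertex K u.
  apply: contrapT => alone.
  have all_y (z : geom) : z = y.
    have [s [Ks sz sum1]] := bary_supp z.
    have z0 x : x != v -> z x = 0.
      move=> xv; apply: sz; apply/negP => xs; apply: alone; exists x; split=> //.
      exact: simplex_sub Ks xs.
    apply: bary_inj => x; rewrite Ey /delta; case: eqP => [<-|/eqP]; last by rewrite eq_sym => /z0.
    have vs : v \in s.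
      by apply: contrapT => /negP /sz zv; move: sum1; rewrite big1 => [/esym/eqP|x' _];
        [rewrite oner_eq0|have [->|/z0] := eqVneq x' v].
    by rewrite -sum1 (big_fsetD1 v vs) /= big1_fset ?addr0 // => x'; rewrite !inE => /andP[/z0].
  have c1 : circle R (1, 0) by rewrite /circle /= expr1n expr0n /= addr0.
  have c2 : circle R (- 1, 0) by rewrite /circle /= sqrrN expr1n expr0n /= addr0.
  have := gK c1; rewrite (all_y (g _)) -(all_y (g (-1, 0))) gK // => -[].
  lra.
have [z Ez] := vertex_point Ku.
(* the only point where the coordinate of v can equal 1/2 *)
have half (x : geom) : x v = 2^-1 -> forall t, x t = 2^-1 * delta R v t + 2^-1 * delta R w0 t.
  move=> xv; have [s [Ks sx sum1]] := bary_supp x.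
  have vs : v \in s.
    by apply: contrapT => /negP /sx xv0; move: xv; rewrite xv0 => /esym/eqP; rewrite invr_eq0 pnatr_eq0.
  have xw w : w != v -> w != w0 -> x w = 0.
    move=> wv ww; apply: sx; apply/negP => ws; move/eqP: ww; apply; apply: only => //.
    exact: simplex_sub2 Ks vs ws.
  have rest : \sum_(i <- (s `\ v)%fset) x i = 2^-1.
    by move: sum1; rewrite (big_fsetD1 v vs) /= xv; lra.
  have w0s : w0 \in (s `\ v)%fset.
    apply: contrapT => /negP w0s; move: rest; rewrite big1_fset; first by lra.
    move=> w ws _; apply: xw; first by move: ws; rewrite !inE => /andP[].
    by apply: contraNneq w0s => <-.
  have w0v : w0 != v by move: w0s; rewrite !inE => /andP[].
  have xw0 : x w0 = 2^-1.
    move: rest; rewrite (big_fsetD1 w0 w0s) /= big1_fset ?addr0 // => w ws _.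
    by move: ws; rewrite !inE => /and3P[ww wv _]; exact: xw.
  move=> t; have [->|tv] := eqVneq t v.
    by rewrite xv /delta eqxx (negPf w0v) /= mulr1 mulr0 addr0.
  have [->|tw] := eqVneq t w0; first by rewrite xw0 /delta eqxx (eq_sym v) (negPf w0v) /= mulr1 mulr0 add0r.
  by rewrite xw // /delta (eq_sym v) (negPf tv) (eq_sym w0) (negPf tw) /= !mulr0 addr0.
have yv : y v = 1 by rewrite Ey /delta eqxx.
have zv : z v = 0 by rewrite Ez /delta (negPf uv).
have cross_half p ty tz : circle R p -> g (rot p ty) = y -> g (rot p tz) = z ->
    exists2 t, Num.min ty tz <= t <= Num.max ty tz & (g (rot p t)) v = 2^-1.
  move=> cp Ety Etz; pose F t := (g (rot p t)) v.
  have cF : continuous F.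
    move=> t; apply: (@continuous_comp _ _ _ (g \o rot p) (fun x : geom => x v)).
      exact: wrap_continuous.
    exact: coord_continuous.
  have Fy : F ty = 1 by rewrite /F Ety.
  have Fz : F tz = 0 by rewrite /F Etz.
  have [le|lt] := leP ty tz.
  - have [|t] := @IVT R F ty tz 2^-1 le (continuous_subspaceT cF).
      by rewrite Fy Fz ge_min le_max; apply/andP; split; apply/orP; [right|left]; lra.
    by rewrite in_itv /=; exists t.
  - have [|t] := @IVT R F tz ty 2^-1 (ltW lt) (continuous_subspaceT cF).
      by rewrite Fy Fz ge_min le_max; apply/andP; split; apply/orP; [left|right]; lra.
    by rewrite in_itv /=; exists t.
have [[q qv]|none] := pselect (exists q : geom, q v = 2^-1); last first.
  have c1 : circle R (1, 0) by rewrite /circle /= expr1n expr0n /= addr0.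
  have [ty _ Ety] := wrap_surj y c1; have [tz _ Etz] := wrap_surj z c1.
  have [t _ Et] := cross_half _ _ _ c1 Ety Etz.
  by apply: none; exists (g (rot (1, 0) t)).
have cp := fS q.
have [ty ty0 Ety] := wrap_surj y cp; have [tz tz0 Etz] := wrap_surj z cp.
have inside t x : 0 <= t <= pi *+ 2 -> g (rot (f q) t) = x -> x v != 2^-1 -> 0 < t < pi *+ 2.
  move=> /andP[t0 t2] E xv.
  have r0 : rot (f q) 0 = f q by rewrite /rot cos0 sin0; case: (f q) => ? ? /=; congr pair; ring.
  have r2 : rot (f q) (pi *+ 2) = f q by rewrite /rot cos2pi sin2pi; case: (f q) => ? ? /=; congr pair; ring.
  rewrite !lt_neqAle t0 t2 !andbT; apply/andP; split; apply: contraNneq xv => Et.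
    by rewrite -E -Et r0 fK qv.
  by rewrite -E Et r2 fK qv.
have /andP[ty1 ty2] : 0 < ty < pi *+ 2.
  by apply: inside ty0 Ety _; rewrite yv; apply/eqP; lra.
have /andP[tz1 tz2] : 0 < tz < pi *+ 2.
  by apply: inside tz0 Etz _; rewrite zv; apply/eqP; lra.
have [t /andP[t1 t2] Et] := cross_half _ _ _ cp Ety Etz.
apply: (@rot_fix (f q) t cp).
  by move: t1 t2; rewrite ge_min le_max => /orP[?|?] /orP[?|?]; apply/andP; split; lra.
rewrite -[LHS]gK; last exact: rot_circle.
by congr f; apply: bary_inj => x; rewrite (half _ Et) (half q).
Qed.
End CircleSpace.

Section GraphCycle.
Variables (V : choiceType) (e : V -> V -> Prop) (D : {fset V}).
Hypothesis esym : forall a b, e a b -> e b a.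
Hypothesis eD : forall a b, e a b -> a \in D.
Hypothesis eirr : forall a b, e a b -> a != b.
Hypothesis branch : forall a b, e a b -> exists2 b', e a b' & b' != b.

(** A simple path whose first vertex has all its neighbours outside the path can be prolonged; in a
finite graph this must stop, and then a second neighbour of the first vertex closes a cycle. *)
Lemma graph_cycle a b : e a b -> exists c (p : seq V), [/\ uniq (c :: p), (2 <= size p)%N &
  chain e c (rcons p c)].
Proof.
move=> ab; apply: contrapT => no.
have long : forall m, exists x y s, [/\ chain e x (y :: s), uniq [:: x, y & s] & size s = m].
  elim=> [|m [x [y [s [ch us sz]]]]].
    by exists a, b, [::]; split=> //=; rewrite inE eirr.
  have [w xw wy] := branch (proj1 ch).
  have [ws|ws] := boolP (w \in [:: x, y & s]); last first.
    exists w, x, (y :: s); split; [by split=> //; exact: esym| |by rewrite /= sz].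
    by rewrite cons_uniq ws.
  exfalso; move: ws; rewrite !inE eq_sym (negPf (eirr xw)) (negPf wy) /= => ws.
  case/splitPr: ws ch us sz => A B ch us _; apply: no.
  exists x, (y :: rcons A w); split.
  - by have := us; rewrite -cat_rcons -(cat_cons y) -(cat_cons x) cat_uniq => /and3P[H _ _].
  - by rewrite /= size_rcons.
  - move: ch; rewrite -cat_rcons -cat_cons => /chain_cat[ch _].
    by rewrite rcons_cons -rcons_cons chain_rcons /= last_rcons; split=> //; exact: esym.
have [x [y [s [ch us sz]]]] := long #|` D|.
have : (size [:: x, y & s] <= #|` D|)%N.
  apply: uniq_leq_size => // w; rewrite inE => /orP[/eqP->|]; first exact: eD (proj1 ch).
  elim: (y :: s) (x) ch => //= z t IH x' [xz ch]; rewrite inE => /orP[/eqP->|zt]; last exact: IH ch zt.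
  exact: eD (esym xz).
by rewrite /= sz; lia.
Qed.
End GraphCycle.

Section CircleCycle.
Variables (R : realType) (V : choiceType) (K : complex V).
Hypothesis hK : homeomorphic_to_circle R (realization R V K).

Lemma circle_no_triangle a b c : ~ triangle K a b c.
Proof. by move: hK => [f [g [cf cg fS fK gK]]]; exact: (no_triangle cf fS fK). Qed.

Lemma circle_graph_cycle : exists c (p : seq V), [/\ uniq (c :: p), (2 <= size p)%N &
  edge_walk K (c :: rcons p c)].
Proof.
move: hK => [f [g [cf cg fS fK gK]]].
pose e a b := a != b /\ K [fset a; b]%fset.
have [D HD] := finite_vertices cg fS fK.
have Kv a b : K [fset a; b]%fset -> vertex K a.
  by move=> Kab; apply: simplex_sub Kab _; rewrite !inE eqxx.
have [v Kv0] : exists v, vertex K v.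
  have [s [Ks _ _]] := bary_supp (g (1, 0)).
  by have /fset0Pn[v vs] := simplex_neq0 Ks; exists v; exact: simplex_sub Ks vs.
have [w [wv _ Kvw]] := no_leaf cg fS fK gK v Kv0.
have esym a b : e a b -> e b a by case=> ab Kab; split; rewrite 1?eq_sym // fsetUC.
have [||||c [p [up sp ch]]] := @graph_cycle V e D esym _ _ _ v w.
- by move=> a b [_ /Kv/HD].
- by move=> a b [].
- move=> a b [ab Kab]; have [b' [b'a b'b Kab']] := no_leaf cg fS fK gK b (Kv _ _ Kab).
  by exists b' => //; split=> //; rewrite eq_sym.
- by split=> //; rewrite eq_sym.
exists c, p; split=> //.
suff H s a : chain e a s -> edge_walk K (a :: s) by exact: H.
elim: s a => [|b s IH] a //= [[ab Kab] /IH[srt H]]; split; first by rewrite /= ab.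
move=> x y; by rewrite /= (negPf ab) inE => /orP[/eqP[-> ->]|/H].
Qed.
End CircleCycle.

(** * Fillings of the rows of a grid *)

Section Rows.
Variables (V : choiceType) (X : complex V).

Definition fillable (s : seq V) := exists n, filling X s n.

Lemma darts_stutter (A : seq V) a B : darts (A ++ a :: a :: B) = darts (A ++ a :: B).
Proof. by rewrite darts_cat (darts_cat A a B) /= eqxx. Qed.

(** A triangle of the grid may be degenerate, with labels that coincide. *)
Lemma fillable_step (A : seq V) a x b B : X [fset a; x; b]%fset ->
  fillable (A ++ a :: x :: b :: B) <-> fillable (A ++ a :: b :: B).
Proof.
move=> Xabx; rewrite /fillable.
have [<-|ax] := eqVneq a x; first by rewrite /filling darts_stutter.
have [<-|xb] := eqVneq x b.
  by rewrite /filling -(cat_rcons a) darts_stutter cat_rcons.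
have [E|ab] := eqVneq a b.
  subst b; split=> -[n H]; exists n.
    by rewrite /filling darts_stutter; apply/(filling_fold X A a x B n).
  by apply/(filling_fold X A a x B n); rewrite /filling -darts_stutter.
have t : triangle X a b x.
  by split=> //; rewrite 1?eq_sym // -fsetUA (fsetUC [fset b]%fset) fsetUA.
by split=> -[n H]; exists n.+1; [apply: filling_push t H|apply: filling_pull t H].
Qed.

(** The strip between two rows is swept square by square, each square in two triangles. *)
Lemma fillable_rows (x y : nat -> V) m : x 0%N = y 0%N -> x m = y m ->
  (forall i, (i < m)%N -> X [fset y i; x i; x i.+1]%fset /\ X [fset y i; y i.+1; x i.+1]%fset) ->
  fillable (mkseq y m.+1) -> fillable (mkseq x m.+1).
Proof.
move=> x0 xm Hm.
have mk z : mkseq z m.+1 = mkseq z m ++ [:: z m] by rewrite /mkseq -addn1 iotaD map_cat.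
pose W k := mkseq y k ++ y k :: [seq x i | i <- iota k (m.+1 - k)].
have step k : (k < m)%N -> fillable (W k.+1) -> fillable (W k).
  move=> km H; have [X1 X2] := Hm k km.
  have E1 : W k = mkseq y k ++ y k :: x k :: x k.+1 :: [seq x i | i <- iota k.+2 (m - k.+1)].
    by rewrite /W subSn ?(ltnW km) //= -(subnSK km).
  have E2 : W k.+1 = mkseq y k ++ y k :: y k.+1 :: x k.+1 :: [seq x i | i <- iota k.+2 (m - k.+1)].
    by rewrite /W subSn // /mkseq -[in iota 0 _]addn1 iotaD map_cat -catA.
  by rewrite E1 fillable_step // -(fillable_step _ _ X2) -E2.
have all k : (k <= m)%N -> fillable (W m) -> fillable (W (m - k)%N).
  elim: k => [|k IH] km H; first by rewrite subn0.
  by apply: step; [lia|rewrite subnSK //; apply: IH => //; exact: ltnW].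
have Wm : fillable (W m) <-> fillable (mkseq y m.+1).
  by rewrite /W subSnn /= xm mk /fillable /filling darts_stutter.
have W0 : fillable (W 0%N) <-> fillable (mkseq x m.+1).
  by rewrite /W subn0 /= -x0 /fillable /filling (darts_stutter [::]).
by move/Wm/(all m (leqnn _)); rewrite subnn => /W0.
Qed.

Lemma darts_const (c : V) m : darts (mkseq (fun=> c) m) = [::].
Proof.
case: m => // m; rewrite /mkseq /=; elim: m 1%N => //= m IH k.
by rewrite eqxx IH.
Qed.

(** Repeating every vertex K times does not change the word of a walk. *)
Lemma darts_blocks (u : nat -> V) (K n : nat) : (0 < K)%N ->
  darts (mkseq (fun i => u (i %/ K)%N) (n * K)%N.+1) = darts (mkseq u n.+1).
Proof.
move=> K0; elim: n => [|n IH]; first by rewrite mul0n.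
have mk z m : mkseq z m.+1 = rcons (mkseq z m) (z m) by rewrite /mkseq -cats1 -addn1 iotaD map_cat.
pose z i := u (i %/ K)%N.
have blk j : (j < K)%N -> darts (mkseq z (n * K + j)%N.+1) = darts (mkseq u n.+1).
  elim: j => [_|j IHj jK]; first by rewrite addn0.
  have zj i : (i < K)%N -> z (n * K + i)%N = u n by move=> iK; rewrite /z divnMDl // divn_small // addn0.
  rewrite (mk _ z) zj // addnS (mk _ z) zj ?(ltnW jK) // -!cats1 -catA /= darts_stutter cats1.
  have := IHj (ltnW jK); rewrite mk zj ?(ltnW jK) //.
rewrite mulSnr.
have EK : (n * K + K)%N = (n * K + K.-1).+1 by rewrite -addnS prednK.
have zK : z (n * K + K)%N = u n.+1 by rewrite /z -mulSnr mulnK.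
have zK1 : z (n * K + K.-1)%N = u n by rewrite /z divnMDl // divn_small ?addn0 // prednK.
have -> : mkseq z (n * K + K)%N.+1 = mkseq z (n * K + K.-1)%N ++ [:: u n; u n.+1].
  by rewrite mk zK {1}EK mk zK1 -!cats1 -catA.
have -> : mkseq u n.+2 = mkseq u n ++ [:: u n; u n.+1] by rewrite !mk -!cats1 -catA.
rewrite !darts_cat; congr (_ ++ _).
by rewrite -mk -zK1 -mk blk // prednK.
Qed.
End Rows.

(** * Contractible loops have fillings *)

Section Homotopy.
Variables (R : realType) (V : choiceType) (X : complex V).
Notation geom := (realization R V X).

Lemma positive_mem (y : geom) s v : supported s y -> 0 < y v -> v \in s.
Proof. by move=> sy; apply: contraLR => /sy ->; rewrite ltxx. Qed.

Lemma positive_face (y : geom) a b c : 0 < y a -> 0 < y b -> 0 < y c -> X [fset a; b; c]%fset.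
Proof.
have [s [Xs sy _]] := bary_supp y.
move=> /(positive_mem sy) sa /(positive_mem sy) sb /(positive_mem sy) sc.
apply: simplex_face Xs _ _; first by apply/fset0Pn; exists a; rewrite !inE eqxx.
by apply/fsubsetP => v; rewrite !inE -orbA => /or3P[]/eqP->.
Qed.

Let square : set (R * R) := `[0, 1] `*` `[0, 1].

(** The Lebesgue number of the cover of the square by the preimages of open stars. *)
Lemma star_lebesgue_number (H : R * R -> geom) : {within square, continuous H} ->
  exists2 d : R, 0 < d & forall x, square x -> exists v,
    forall y, square y -> ball x d y -> 0 < H y v.
Proof.
move=> cH.
have cS : compact square by apply: compact_setX; exact: segment_compact.
pose P (d : R) x := exists v, forall y, square y -> ball x d y -> 0 < H y v.
have loc x : square x -> \forall x' \near x & d \near (0 : R)^'+, P d x'.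
  move=> Sx; have [v v0] := positive_coord (H x).
  have [e /= e0 He] : exists2 e : R, 0 < e & forall y, square y -> ball x e y -> 0 < H y v.
    have oU : open [set y : geom | 0 < y v].
      exact: (@coord_open R V X v [set r | 0 < r] (@open_gt R 0)).
    have /subspace_continuousP/(_ x Sx) /(_ _ (open_nbhs_nbhs (conj oU v0))) := cH.
    by move=> /nbhs_ballP[e /= e0 He]; exists e => // y Sy xy; exact: He.
  exists (ball x (e / 2), [set d | d < e / 2]).
    split; first by apply: nbhsx_ballx; rewrite divr_gt0.
    by apply: nbhs_right_lt; rewrite divr_gt0.
  move=> [x' d] /= [xx' de]; exists v => y Sy x'y; apply: He => //.
  have -> : e = e / 2 + e / 2 by lra.
  by apply: ball_triangle xx' _; apply: le_ball x'y; exact: ltW.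
have /compact_near_coveringP cov := cS.
have := cov _ (0 : R)^'+ P _ loc => cov'.
have : \forall d \near (0 : R)^'+, 0 < d /\ square `<=` P d.
  near=> d; split; first by near: d; exact: nbhs_right_gt.
  by near: d; exact: cov'.
by move=> /filter_ex[d [d0 Hd]]; exists d => // x /Hd.
Unshelve. all: by end_near. Qed.

Lemma positive_delta (y : geom) a v : (forall u, y u = delta R a u) -> 0 < y v -> v = a.
Proof. by move=> E; rewrite E /delta; case: eqP => [->|_]; rewrite ?ltxx. Qed.

(** A grid on the square labels each cell by a vertex whose open star contains the image of the
cell.  Cells with a common point have labels in a common simplex, namely the support of the
image of that point.  So consecutive rows differ by squares that can be filled, and the last
row is constant.  The first row runs along the given walk, since the number of cells is a
multiple of its number of edges. *)
Lemma simply_connected_fillable c q : simply_connected R geom -> (0 < size q)%N ->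
  last c q = c -> edge_walk X (c :: q) -> fillable X (c :: q).
Proof.
move=> sc q0 lq [srt He]; pose n := size q; pose u := nth c (c :: q).
have uE i : (i < n)%N -> X [fset u i; u i.+1]%fset.
  by move=> si; apply: He; apply: mem_darts.
have un : u n = c by rewrite /u nth_last.
have ep : edge_path X c (c :: q) by move=> i si; exact: uE.
have [h [Eh ch sh]] := edge_path_param R q0 ep.
have n0 : 0 < n%:R :> R by rewrite ltr0n.
have hnat i : (i <= n)%N -> forall v, h i%:R v = delta R (u i) v.
  move=> sn v; rewrite Eh; last by rewrite ler0n ler_nat.
  have [lt|ge] := ltnP i n.
    have seg : i%:R <= (i%:R : R) <= i.+1%:R.
      by apply/andP; split; [exact: lexx|rewrite ler_nat].
    by rewrite (@path_coord_segment R V c c q i i%:R v lt seg) subrr /u; lra.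
  have -> : i = n by apply/eqP; rewrite eqn_leq sn.
  have lt : (n.-1 < size q)%N by rewrite /n prednK.
  have seg : n.-1%:R <= (n%:R : R) <= n.-1.+1%:R.
    by rewrite prednK //; apply/andP; split; [rewrite ler_nat leq_pred|exact: lexx].
  rewrite (@path_coord_segment R V c c q n.-1 n%:R v lt seg) prednK //.
  have -> : n%:R - n.-1%:R = 1 :> R by rewrite -natrB ?leq_pred // -subn1 subKn.
  by rewrite /u; lra.
pose f t := h (n%:R * t).
have f0 v : f 0 v = delta R c v by rewrite /f mulr0 (hnat 0%N).
have f1 : f 0 = f 1 by apply: bary_inj => v; rewrite f0 /f mulr1 hnat // un.
have cf : {within `[0, 1], continuous f}.
  have cm : {within `[0, 1], continuous (fun t : R => n%:R * t)}.
    by apply: continuous_subspaceT => t; apply: cvgM; [exact: cvg_cst|exact: cvg_id].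
  apply: (@within_comp R R geom `[0, 1]%classic `[0, n%:R]%classic (fun t => n%:R * t) h cm ch).
  move=> t /=; rewrite !in_itv /= => /andP[t0 t1]; apply/andP; split; first by rewrite mulr_ge0.
  by rewrite ler_piMr // ltW.
have [H [cH H0 H1 Hs]] := sc f cf f1.
have [d d0 Hd] := star_lebesgue_number cH.
(* Each edge of the walk is cut into K pieces, so that the cells have size 1 / M < d. *)
pose K := (Num.bound d^-1).+1.
have K0 : 0 < K%:R :> R by rewrite ltr0n.
pose M := (n * K)%N.
have M0 : (0 < M)%N by rewrite muln_gt0 q0.
have M0' : 0 < M%:R :> R by rewrite ltr0n.
have Md : M%:R^-1 < d.
  rewrite invf_plt // ?posrE //; apply: lt_le_trans (archi_boundP _) _.
    by rewrite invr_ge0 ltW.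
  by rewrite ler_nat /M; apply: leq_trans (leqnSn _) _; rewrite leq_pmull.
pose pt i : R := i%:R / M%:R.
have pt0 : pt 0%N = 0 by rewrite /pt mul0r.
have pt1 : pt M = 1 by rewrite /pt divff // gt_eqF.
have ptS i : pt i.+1 = pt i + M%:R^-1 by rewrite /pt -natr1 mulrDl mul1r.
have pt_le i j : (i <= j)%N -> pt i <= pt j by move=> ij; rewrite /pt ler_pM2r ?invr_gt0 // ler_nat.
have pt_in i : (i <= M)%N -> 0 <= pt i <= 1.
  by move=> iM; rewrite -pt0 -pt1 !pt_le.
have [g Hg] : exists g : nat * nat -> V, forall p, (p.1 < M)%N -> (p.2 < M)%N -> forall a b,
    (p.1 <= a <= p.1.+1)%N -> (p.2 <= b <= p.2.+1)%N -> 0 < H (pt a, pt b) (g p).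
  have : forall p : nat * nat, exists v, (p.1 < M)%N -> (p.2 < M)%N -> forall a b,
      (p.1 <= a <= p.1.+1)%N -> (p.2 <= b <= p.2.+1)%N -> 0 < H (pt a, pt b) v.
    move=> [i j] /=; have [iM|iM] := ltnP i M; last by exists c.
    have [jM|jM] := ltnP j M; last by exists c.
    have sq a b : (a <= M)%N -> (b <= M)%N -> square (pt a, pt b).
      by move=> aM bM; split; rewrite /= in_itv /=; exact: pt_in.
    have [v Hv] := Hd (pt i, pt j) (sq _ _ (ltnW iM) (ltnW jM)).
    exists v => _ _ a b /andP[ia ai] /andP[jb bj]; apply: Hv.
      by apply: sq; [exact: leq_trans ai iM|exact: leq_trans bj jM].
    have near1 k l : (k <= l <= k.+1)%N -> `|pt k - pt l| < d.
      move=> /andP[kl lk]; have := pt_le _ _ kl; have := pt_le _ _ lk; rewrite ptS => l1 l2.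
      by rewrite distrC ger0_norm ?subr_ge0 //; apply: le_lt_trans Md; lra.
    by split; rewrite /ball /=; apply: near1; rewrite ?ia ?jb.
  by move=> /choice[g Hg]; exists g.
have self k : (k <= k <= k.+1)%N by rewrite leqnn leqnSn.
have pre : (M.-1 <= M <= M.-1.+1)%N by rewrite prednK // leq_pred leqnn.
have preM : (M.-1 < M)%N by rewrite prednK.
have left j : (j < M)%N -> g (0%N, j) = c.
  move=> jM; apply: (positive_delta f0); have := Hg (0%N, j) M0 jM 0%N j (self _) (self _).
  by rewrite pt0 (Hs _ _).1 // pt_in // ltnW.
have right j : (j < M)%N -> g (M.-1, j) = c.
  move=> jM; apply: (positive_delta f0); have := Hg (M.-1, j) preM jM M j pre (self _).
  by rewrite pt1 (Hs _ _).2 // pt_in // ltnW.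
have top i : (i < M)%N -> g (i, M.-1) = c.
  move=> iM; apply: (positive_delta f0); have := Hg (i, M.-1) iM preM i M (self _) pre.
  by rewrite pt1 H1 // pt_in // ltnW.
(* The additional last column makes all rows end at c. *)
pose row j i := if (i < M)%N then g (i, j) else c.
have Xc : X [fset c; c; c]%fset.
  by rewrite !fsetUid; apply: simplex_sub (uE 0%N q0) _; rewrite !inE eqxx.
have row0 j : (j < M)%N -> row j 0%N = c by move=> jM; rewrite /row M0 left.
have rowM j : row j M = c by rewrite /row ltnn.
have row_step j : (j.+1 < M)%N -> fillable X (mkseq (row j.+1) M.+1) -> fillable X (mkseq (row j) M.+1).
  move=> jM; have jM' := ltnW jM; apply: fillable_rows; rewrite ?row0 ?rowM // => i iM.
  have [iM1|iM1] := ltnP i.+1 M.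
    rewrite /row iM iM1.
    have G a b : (a <= i.+1 <= a.+1)%N -> (b <= j.+1 <= b.+1)%N -> (a < M)%N -> (b < M)%N ->
      0 < H (pt i.+1, pt j.+1) (g (a, b)) by move=> ha hb aM bM; exact: Hg.
    by split; apply: positive_face; apply: G; rewrite ?leqnn ?leqnSn.
  have Ei : i = M.-1 by lia.
  have iE k : (k < M)%N -> row k i = c by move=> kM; rewrite /row iM Ei right.
  have iE1 k : row k i.+1 = c by rewrite /row ltnNge iM1.
  by rewrite !iE // !iE1.
have rowT : fillable X (mkseq (row M.-1) M.+1).
  exists 0%N; rewrite /filling (_ : mkseq _ _ = mkseq (fun=> c) M.+1) ?darts_const.
    exact: fill_nil.
  by apply: eq_map => i; rewrite /row; case: ltnP => // /top.
have row_all k : (k < M)%N -> fillable X (mkseq (row (M.-1 - k)%N) M.+1).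
  elim: k => [|k IH] kM; first by rewrite subn0.
  have kM1 : (k < M.-1)%N by rewrite -ltnS prednK.
  apply: row_step; rewrite subnSK //; last by apply: IH; exact: ltnW.
  exact: leq_ltn_trans (leq_subr _ _) preM.
have rowB : fillable X (mkseq (row 0%N) M.+1).
  by have := row_all M.-1; rewrite subnn prednK // leqnn; apply.
have npt i : n%:R * pt i = i%:R / K%:R.
  by rewrite /pt /M natrM invfM mulrCA mulVKf // gt_eqF.
have bottom i : (i < M)%N -> 0 < f (pt i) (row 0%N i).
  move=> iM; have := Hg (i, 0%N) iM M0 i 0%N (self _) (self _).
  by rewrite /row iM pt0 H0 // pt_in // ltnW.
have B1 i : (i < M)%N -> row 0%N i \in [fset u (i %/ K)%N; u (i %/ K)%N.+1]%fset.
  move=> iM; apply: positive_mem (bottom i iM); apply: sh; first by rewrite ltn_divLR.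
  rewrite npt ler_pdivlMr // ler_pdivrMr // -!natrM !ler_nat leq_divM /=.
  by rewrite ltnW // ltn_ceil.
have B2 a : (a <= n)%N -> row 0%N (a * K)%N = u a.
  move=> an; have [lt|ge] := ltnP (a * K)%N M; last first.
    by rewrite /row ltnNge ge /=; have -> : a = n by move: ge; rewrite /M leq_pmul2r //; lia.
  apply: (positive_delta _ (bottom _ lt)) => v.
  by rewrite /f npt natrM mulfK ?gt_eqF // hnat.
pose z i := u (i %/ K)%N.
have fz : fillable X (mkseq z M.+1).
  apply: fillable_rows rowB; first by rewrite row0 // /z div0n.
    by rewrite rowM /z /M mulnK.
  move=> i iM; set a := (i %/ K)%N; have an : (a < n)%N by rewrite ltn_divLR.
  have face x y w : x \in [fset u a; u a.+1]%fset -> y \in [fset u a; u a.+1]%fset ->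
      w \in [fset u a; u a.+1]%fset -> X [fset x; y; w]%fset.
    move=> hx hy hw; apply: simplex_face (uE a an) _ _.
      by apply/fset0Pn; exists x; rewrite !inE eqxx.
    by apply/fsubsetP => v; rewrite !inE -orbA => /or3P[]/eqP->; rewrite -in_fset2.
  have m1 : row 0%N i \in [fset u a; u a.+1]%fset by exact: B1.
  have m2 : z i \in [fset u a; u a.+1]%fset by rewrite !inE eqxx.
  have [m3 m4] : z i.+1 \in [fset u a; u a.+1]%fset /\ row 0%N i.+1 \in [fset u a; u a.+1]%fset.
    have [Ea|Ea] : (i.+1 %/ K)%N = a \/ i.+1 = (a.+1 * K)%N.
      have := ltn_ceil i (ltn0Sn _ : (0 < K)%N); rewrite -/a leq_eqVlt => /orP[/eqP|lt]; first by right.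
      left; apply/eqP; rewrite eqn_leq -ltnS ltn_divLR // lt /= leq_div2r //.
    - have iM1 : (i.+1 < M)%N by rewrite -ltn_divLR // Ea.
      by split; [rewrite /z Ea !inE eqxx|rewrite -Ea; exact: B1].
    - by rewrite Ea B2 // /z mulnK // !inE eqxx orbT.
  by split; exact: face.
case: fz => m; rewrite /filling darts_blocks // => Hm; exists m.
by move: Hm; rewrite /u -{2}(mkseq_nth c (c :: q)).
Qed.
End Homotopy.

(** * Simply connected, locally large complexes are large *)

Lemma darts_belast (V : choiceType) (a : V) s : sorted (fun x y => x != y) (a :: s) ->
  map fst (darts (a :: s)) = belast a s.
Proof.
by elim: s a => [|b s IH] a //= /andP[/negPf ab srt]; rewrite ab /= -IH.
Qed.

Section Systolic.
Variables (R : realType) (V : choiceType) (X : length_complex R V).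
Hypothesis sysX : systolic_by_function X.

Lemma systolic_walk_len c q : (0 < size q)%N -> last c q = c -> edge_walk X (c :: q) ->
  (forall a b, (a, b) \in darts (c :: q) -> (b, a) \notin darts (c :: q)) ->
  (forall a b d, (a, b) \in darts (c :: q) -> (b, d) \in darts (c :: q) -> ~ triangle X a b d) ->
  2 <= walk_len X (c :: q).
Proof.
move=> q0 lq ew nb nc; have [_ sc lg] := sysX; have [srt _] := ew.
have [n Hn] := simply_connected_fillable sc q0 lq ew.
have ex : exists n, `[< filling X (c :: q) n >] by exists n; apply/asboolP.
case: (ex_minnP ex) => n0 /asboolP Hn0 min.
rewrite walk_len_path //; apply: (closed_walk_length _ _ nb nc _ srt Hn0 erefl) => //.
- by move=> m Hm; apply: min; apply/asboolP.
- by move=> x d p /lg; exact: short_link_filling.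
Qed.

(** The perimeter is at most 3/2 < 2. *)
Lemma systolic_triangle a b c : a != b -> b != c -> c != a ->
  X [fset a; b]%fset -> X [fset b; c]%fset -> X [fset c; a]%fset -> X [fset a; b; c]%fset.
Proof.
move=> ab bc ca Xab Xbc Xca; apply: contrapT => no.
have dE : darts [:: a; b; c; a] = [:: (a, b); (b, c); (c, a)].
  by rewrite /= (negPf ab) (negPf bc) (negPf ca).
have ba : b != a by rewrite eq_sym.
have cb : c != b by rewrite eq_sym.
have ac : a != c by rewrite eq_sym.
have : 2 <= walk_len X [:: a; b; c; a].
  apply: systolic_walk_len => //.
  - split; first by rewrite /= ab bc ca.
    by move=> x y; rewrite dE !inE => /or3P[]/eqP[-> ->].
  - move=> x y; rewrite dE !inE !xpair_eqE => /or3P[]/andP[/eqP-> /eqP->];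
      by rewrite ?eqxx ?(negPf ab) ?(negPf ba) ?(negPf bc) ?(negPf cb) ?(negPf ca) ?(negPf ac).
  - have nt : ~ triangle X a b c by case.
    move=> x y z; rewrite dE !inE !xpair_eqE => /or3P[]/andP[/eqP-> /eqP->];
      rewrite ?eqxx ?(negPf ab) ?(negPf ba) ?(negPf bc) ?(negPf cb) ?(negPf ca) ?(negPf ac) /= ?orbF ?orFb => /eqP -> t;
      apply: nt => //; [exact/triangle_rot/triangle_rot|exact: triangle_rot].
rewrite /walk_len dE !big_cons big_nil /=.
have /andP[_ h1] := edge_len_bounds ab Xab; have /andP[_ h2] := edge_len_bounds bc Xbc.
have /andP[_ h3] := edge_len_bounds ca Xca; lra.
Qed.

(** Remove one vertex; the other ones span a simplex of its link, which is flag. *)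
Lemma systolic_flag : flag X.
Proof.
move=> s s0 sv se; have [_ _ lg] := sysX.
have Xe u w : u \in s -> w \in s -> u != w -> X [fset u; w]%fset.
  by move=> us ws uw; have [] := se u w us ws uw.
case/fset0Pn: (s0) => v vs; have [E|ne] := eqVneq (s `\ v)%fset fset0.
  have -> : s = [fset v]%fset by rewrite -(fsetD1K vs) E fsetU0.
  exact: sv.
have [fl _] := lg v (sv v vs).
have [||_ _] := fl (s `\ v)%fset ne; last by rewrite fsetD1K.
- move=> u; rewrite !inE => /andP[uv us]; split; first exact: sv.
    by rewrite inE eq_sym.
  by apply: Xe => //; rewrite eq_sym.
- move=> u w; rewrite !inE => /andP[uv us] /andP[wv ws] uw; apply: edge_pair => //.
  split; [exact: Xe|by rewrite !inE negb_or !(eq_sym v) uv wv|].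
  by rewrite fsetUA; apply: systolic_triangle => //; rewrite 1?eq_sym //; apply: Xe => //; rewrite eq_sym.
Qed.

(** By fullness and [circle_no_triangle], no triangle of X has two edges on the closed
walk found in the cycle. *)
Lemma systolic_cycle s : Defs.cycle R s X -> full s X -> (2%:E <= cycle_length X s)%E.
Proof.
move=> [sub hom] fs.
have [c [p [up sp ew]]] := circle_graph_cycle hom.
have [srt He] := ew.
have szc : size (c :: rcons p c) = (size p).+2 by rewrite /= size_rcons.
have nb a b : (a, b) \in darts (c :: rcons p c) -> (b, a) \notin darts (c :: rcons p c).
  move=> /(darts_nth c srt)[i si [Ea Eb]]; apply/negP => /(darts_nth c srt)[j sj [Eb' Ea']].
  rewrite szc ltnS in si sj; rewrite Eb in Eb'; rewrite Ea in Ea'.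
  have := nth_cl_succ sp up si sj Eb'; have := nth_cl_succ sp up sj si (esym Ea'); lia.
have len2 : 2 <= walk_len X (c :: rcons p c).
  apply: systolic_walk_len => //.
  - by rewrite size_rcons.
  - by rewrite last_rcons.
  - by split=> // a b /He /sub.
  - move=> a b d ab bd [nab nbd nda Xabd]; apply: (circle_no_triangle hom (a := a) (b := b) (c := d)).
    split=> //; apply: fs => // v; rewrite !inE -orbA => /or3P[]/eqP->.
    + by apply: simplex_sub (He _ _ ab) _; rewrite !inE eqxx.
    + by apply: simplex_sub (He _ _ bd) _; rewrite !inE eqxx.
    + by apply: simplex_sub (He _ _ bd) _; rewrite !inE eqxx orbT.
rewrite -lee_fin in len2; apply: le_trans len2 _.
have -> : walk_len X (c :: rcons p c) =
    \sum_(e <- [seq [fset f.1; f.2]%fset | f <- darts (c :: rcons p c)]) len X e.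
  by rewrite big_map.
apply: esum_ge_seq.
- rewrite map_inj_in_uniq.
    have : map fst (darts (c :: rcons p c)) = c :: p.
      by rewrite (darts_belast srt) belast_rcons.
    by move=> E; apply: (@map_uniq _ _ fst); rewrite E.
  move=> [a b] [a' b'] ab ab' /= E.
  have neq x y : (x, y) \in darts (c :: rcons p c) -> x != y.
    by move=> /(darts_nth c srt)[i si [-> ->]]; exact: (sortedP c srt).
  have : a' \in [fset a; b]%fset by rewrite E !inE eqxx.
  have : b' \in [fset a; b]%fset by rewrite E !inE eqxx orbT.
  have := neq _ _ ab'; rewrite !inE => ne /orP[]/eqP Eb /orP[]/eqP Ea; subst a' b' => //.
  - by rewrite eqxx in ne.
  - by have := nb _ _ ab; rewrite ab'.
  - by rewrite eqxx in ne.
- move=> _ /mapP[[a b] ab ->]; have [i si [Ea Eb]] := darts_nth c srt ab.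
  apply: edge_pair; last exact: He.
  by rewrite Ea Eb; exact: (sortedP c srt).
Qed.
End Systolic.

Unset Implicit Arguments.

Theorem theorem2p5 (R : realType) (V : choiceType) (X : length_complex R V) :
  systolic_by_function X -> large X.
Proof. by move=> sysX; split; [exact: systolic_flag|move=> s; exact: systolic_cycle]. Qed.
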